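(* Let $\mathbb{X}$ be a uniformly smooth Banach space of smoothness power type $p\in(1,2]$. If $E\subset\mathbb{X}$ and $S_{E,p}(\mathscr{G})=\mathrm{diam}\,E+\sum_{Q\in\mathscr{G}}\beta_E(Q)^p\,\mathrm{diam}\,Q<\infty$ for some multiresolution family $\mathscr{G}$ for $E$ with inflation factor $A_{\mathscr{G}}\geq 240$, then $E$ is contained in a rectifiable curve $\Gamma$ in $\mathbb{X}$ with $\mathcal{H}^1(\Gamma)\leq C\,S_{E,p}(\mathscr{G})$, where $C<\infty$ depends only on the modulus of smoothness $\rho_{\mathbb{X}}$ and on $A_{\mathscr{G}}$.
   Context: All Banach spaces are real of dimension at least 2. The modulus of smoothness of $\mathbb{X}$ is $\rho_{\mathbb{X}}(t)=\sup_{|x|=1,|y|=t}\tfrac12(|x+y|+|x-y|)-1$ for $t\geq0$. $\mathbb{X}$ is uniformly smooth if $\rho_{\mathbb{X}}(t)/t\to0$ as $t\to0$, and of smoothness power type $p\in(1,2]$ if in addition there is $C>0$ with $\rho_{\mathbb{X}}(t)\leq Ct^p$ for all $t>0$. For a nonempty set $E\subset\mathbb{X}$ and a set $Q\subset\mathbb{X}$ of positive diameter, the Jones beta number is $\beta_E(Q)=\inf_L\sup_{x\in E\cap Q}\mathrm{dist}(x,L)/\mathrm{diam}\,Q$ if $E\cap Q\neq\emptyset$, where $L$ ranges over all one-dimensional affine subspaces (lines) of $\mathbb{X}$, and $\beta_E(Q)=0$ if $E\cap Q=\emptyset$. For $\rho>0$, a $\rho$-net for $E$ is a set $X\subset E$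 such that $|y-z|\geq\rho$ for all distinct $y,z\in X$ and $\mathrm{dist}(x,X)<\rho$ for all $x\in E$. A multiresolution family for $E$ with inflation factor $A>1$ is the collection of closed balls $\mathscr{G}=\{B(x,A2^{-k}):x\in X_k,\ k\in\mathbb{Z}\}$ (indexed by the pairs $(k,x)$), where $(X_k)_{k\in\mathbb{Z}}$ is a nested family ($X_k\subset X_{k+1}$) and each $X_k$ is a $2^{-k}$-net for $E$. A rectifiable curve is the image of a continuous map from $[0,1]$ with finite one-dimensional Hausdorff measure $\mathcal{H}^1$. *)

(* Defs.v *)
From Stdlib Require Import Reals Lra List ClassicalEpsilon.
Open Scope R_scope.

Record Banach : Type := {
  car :> Type;
  vzero : car;
  vadd : car -> car -> car;
  vopp : car -> car;
  vscal : R -> car -> car;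
  vnorm : car -> R;
  vadd_assoc : forall x y z, vadd x (vadd y z) = vadd (vadd x y) z;
  vadd_comm : forall x y, vadd x y = vadd y x;
  vadd_0 : forall x, vadd x vzero = x;
  vadd_opp : forall x, vadd x (vopp x) = vzero;
  vscal_1 : forall x, vscal 1 x = x;
  vscal_assoc : forall a b x, vscal a (vscal b x) = vscal (a * b) x;
  vscal_distr_v : forall a x y, vscal a (vadd x y) = vadd (vscal a x) (vscal a y);
  vscal_distr_s : forall a b x, vscal (a + b) x = vadd (vscal a x) (vscal b x);
  vnorm_eq0 : forall x, vnorm x = 0 -> x = vzero;
  vnorm_scal : forall a x, vnorm (vscal a x) = Rabs a * vnorm x;
  vnorm_tri : forall x y, vnorm (vadd x y) <= vnorm x + vnorm y;
  vcomplete : forall u : nat -> car,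
      (forall eps, 0 < eps -> exists N, forall m n, (N <= m)%nat -> (N <= n)%nat ->
          vnorm (vadd (u m) (vopp (u n))) < eps) ->
      exists l, forall eps, 0 < eps -> exists N, forall n, (N <= n)%nat ->
          vnorm (vadd (u n) (vopp l)) < eps;
  vdim2 : exists x y : car, forall a b : R,
      vadd (vscal a x) (vscal b y) = vzero -> a = 0 /\ b = 0
}.

Arguments vzero {b0}.
Arguments vadd {b0} _ _.
Arguments vopp {b0} _.
Arguments vscal {b0} _ _.
Arguments vnorm {b0} _.

Definition vdist {X : Banach} (x y : X) : R := vnorm (vadd x (vopp y)).

(** least upper bound of a set of reals (meaningful when it is nonempty and
    bounded above; otherwise an unspecified real) *)
Definition sup_R (S : R -> Prop) : R :=
  epsilon (inhabits 0) (fun s => is_lub S s).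

Definition inf_R (S : R -> Prop) : R := - sup_R (fun r => S (- r)).

Definition bounded {X : Banach} (Q : X -> Prop) : Prop :=
  exists c, forall x y, Q x -> Q y -> vdist x y <= c.

(** diameter (sup of |x-y| over Q, and 0 for the empty set); meaningful for
    bounded Q *)
Definition diam {X : Banach} (Q : X -> Prop) : R :=
  sup_R (fun r => r = 0 \/ exists x y, Q x /\ Q y /\ r = vdist x y).

Definition cball {X : Banach} (c : X) (r : R) : X -> Prop :=
  fun y => vdist y c <= r.

Definition dist_line {X : Banach} (x a v : X) : R :=
  inf_R (fun r => exists t : R, r = vdist x (vadd a (vscal t v))).

(** Jones beta number beta_E(Q) (for Q of positive finite diameter):
    inf over lines L of sup_{x in E cap Q} dist(x,L)/diam Q, and 0 if E cap Q
    is empty (the extra value 0 in the inner sup realizes that convention and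
    does not change the sup otherwise). *)
Definition beta {X : Banach} (E Q : X -> Prop) : R :=
  inf_R (fun s => exists a v : X, v <> vzero /\
     s = sup_R (fun r => r = 0 \/
                 exists x, E x /\ Q x /\ r = dist_line x a v / diam Q)).

Definition rpow (x p : R) : R :=
  match Req_EM_T x 0 with left _ => 0 | right _ => Rpower x p end.

Definition is_modulus_of_smoothness (X : Banach) (rho : R -> R) : Prop :=
  forall t, 0 <= t ->
    is_lub (fun r => exists x y : X, vnorm x = 1 /\ vnorm y = t /\
              r = (vnorm (vadd x y) + vnorm (vadd x (vopp y))) / 2 - 1) (rho t).

Definition uniformly_smooth_mod (rho : R -> R) : Prop :=
  forall eps, 0 < eps -> exists delta, 0 < delta /\
    forall t, 0 < t < delta -> rho t / t < eps.

Definition smoothness_power_type_mod (rho : R -> R) (p : R) : Prop :=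
  1 < p <= 2 /\ uniformly_smooth_mod rho /\
  exists K, 0 < K /\ forall t, 0 < t -> rho t <= K * Rpower t p.

Definition is_net {X : Banach} (E N : X -> Prop) (r : R) : Prop :=
  (forall x, N x -> E x) /\
  (forall y z, N y -> N z -> y <> z -> r <= vdist y z) /\
  (forall x, E x -> exists y, N y /\ vdist x y < r).

Definition multiresolution_nets {X : Banach} (E : X -> Prop) (Xs : Z -> X -> Prop) : Prop :=
  (forall k x, Xs k x -> Xs (k + 1)%Z x) /\
  (forall k, is_net E (Xs k) (powerRZ 2 (- k))).

Definition mr_ball {X : Banach} (A : R) (kx : Z * X) : X -> Prop :=
  cball (snd kx) (A * powerRZ 2 (- fst kx)).

Definition partial_S {X : Banach} (E : X -> Prop) (A p : R) (l : list (Z * X)) : R :=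
  fold_right (fun kx acc => rpow (beta E (mr_ball A kx)) p * diam (mr_ball A kx) + acc) 0 l.

(** S_{E,p}(G) <= M : diam E + sum over G of beta^p diam <= M (the sum of
    nonnegative terms being the sup of its finite partial sums), E bounded *)
Definition S_le {X : Banach} (E : X -> Prop) (Xs : Z -> X -> Prop) (A p M : R) : Prop :=
  bounded E /\
  forall l : list (Z * X), NoDup l -> (forall kx, In kx l -> Xs (fst kx) (snd kx)) ->
    diam E + partial_S E A p l <= M.

(** H^1(G) <= c, via H^1 = sup_{delta>0} H^1_delta *)
Definition H1_le {X : Banach} (G : X -> Prop) (c : R) : Prop :=
  forall delta, 0 < delta -> forall eps, 0 < eps ->
    exists U : nat -> X -> Prop,
      (forall i, bounded (U i) /\ diam (U i) <= delta) /\
      (forall x, G x -> exists i, U i x) /\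
      (forall n, sum_f_R0 (fun i => diam (U i)) n <= c + eps).

Definition continuous_on01 {X : Banach} (g : R -> X) : Prop :=
  forall t, 0 <= t <= 1 -> forall eps, 0 < eps -> exists delta, 0 < delta /\
    forall s, 0 <= s <= 1 -> Rabs (s - t) < delta -> vdist (g s) (g t) < eps.

Definition image01 {X : Banach} (g : R -> X) : X -> Prop :=
  fun y => exists t, 0 <= t <= 1 /\ g t = y.

(* Main.v *)
Require Import Defs.
From Stdlib Require Import Reals List Lra Lia ZArith Permutation Sorted
  Classical ClassicalEpsilon FunctionalExtensionality.
Import ListNotations.
Open Scope R_scope.

(** Order the points of [X_k] in a list. With [s = 2^-k], charge a link [ab] of the list [|a - b|]
    when [|a - b| <= 12 s] and no point of [X_k] is closer to both [a] and [b] than they are to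
    each other, and [|a - b| / 2 + 6 s] otherwise; the cost of the ordering is the sum of the links
    plus [6 s], hence at least half the length of the polygonal line.  Any ordering of [X_k]
    refines to one of [X_(k+1)] by replacing each [x] with the list of the points of [X_(k+1)]
    nearest to it.  Where [E] is close to a line these are sorted along the line: inside a cheap
    link the new points lie almost on the segment, and smoothness bounds the increase of length by
    [C beta^p s]; elsewhere the path overshoots [x] by less than [s], which the reserve [6 s] of
    an expensive link pays for, since the next scale only needs half of it.  Where [E] is not close
    to a line, every new point pays for itself through its own beta number.  So the costs are
    bounded by [C S].  The arc length position of a point in the successive orderings increases
    to a limit, and the points of the nets depend 1-Lipschitz on these limits, which gives
    the curve. *)

(** The obstacle is an adjacent link, priced at its length, that becomes too long for a later scale
    and must then hold a reserve. Pricing gaps at half their length solves this: beyond length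
    [12 s] the discarded half is worth at least the reserve [6 s], so the change of status is free.
    The reserve is the fixed point of its own balance: an overshoot of at most [r] at each end of a
    gap costs [r] inside the block and [r / 2] in the gap, hence [3 r] for both ends, and the next
    scale keeps [6 (r / 2)]; together [6 r].

    The space may be infinite-dimensional, so even the finiteness of the nets has to be derived from
    the finiteness of [S]. There is no orthogonal projection either: coordinates along a line are
    merely chosen, and the lines chosen at neighbouring points are unrelated, even in orientation.
    What passes from one to the other is adjacency, which mentions no line, and the order of a
    common pair of points. Working with orderings instead of a connected graph yields a
    parametrization directly. *)

Notation "x +v y" := (vadd x y) (at level 50, left associativity).
Notation "x -v y" := (vadd x (vopp y)) (at level 50, left associativity).
Notation "a *v x" := (vscal a x) (at level 40, left associativity).

(** * A decision procedure for linear identities *)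

Section LinearIdentities.
Context {X : Banach}.

Lemma vadd_0l (x : X) : vzero +v x = x.
Proof. rewrite vadd_comm; apply vadd_0. Qed.

Lemma vadd_cancel (x y z : X) : x +v z = y +v z -> x = y.
Proof.
  intros H. rewrite <- (vadd_0 _ x), <- (vadd_0 _ y), <- (vadd_opp _ z), !vadd_assoc, H.
  reflexivity.
Qed.

Lemma vscal_0 (x : X) : 0 *v x = vzero.
Proof.
  apply (vadd_cancel _ _ (0 *v x)). rewrite vadd_0l, <- vscal_distr_s.
  now rewrite Rplus_0_l.
Qed.

Lemma vscal_zero (a : R) : a *v (vzero : X) = vzero.
Proof. rewrite <- (vscal_0 vzero), vscal_assoc, Rmult_0_r. reflexivity. Qed.

Lemma vopp_scal (x : X) : vopp x = (-1) *v x.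
Proof.
  apply (vadd_cancel _ _ x). rewrite (vadd_comm _ (vopp x)), vadd_opp.
  rewrite <- (vscal_1 _ x) at 2. rewrite <- vscal_distr_s.
  replace (-1 + 1) with 0 by ring. now rewrite vscal_0.
Qed.

Inductive vexpr :=
| VAtom (n : nat) | VZero | VAdd (e f : vexpr) | VOpp (e : vexpr) | VScal (a : R) (e : vexpr).

Fixpoint veval (env : list X) (e : vexpr) : X :=
  match e with
  | VAtom n => nth n env vzero
  | VZero => vzero
  | VAdd e f => veval env e +v veval env f
  | VOpp e => vopp (veval env e)
  | VScal a e => a *v veval env e
  end.

Fixpoint vcoef (e : vexpr) (i : nat) : R :=
  match e with
  | VAtom n => if Nat.eqb n i then 1 else 0
  | VZero => 0
  | VAdd e f => vcoef e i + vcoef f i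
  | VOpp e => - vcoef e i
  | VScal a e => a * vcoef e i
  end.

Fixpoint lincomb (f : nat -> R) (env : list X) : X :=
  match env with
  | nil => vzero
  | x :: env => f O *v x +v lincomb (fun i => f (S i)) env
  end.

(** A conjunction over the atoms instead of a quantified equality of coefficients, so that [simpl]
    and [repeat split] leave one scalar identity per atom. *)
Fixpoint coef_agree (f g : nat -> R) (env : list X) : Prop :=
  match env with
  | nil => True
  | _ :: env => f O = g O /\ coef_agree (fun i => f (S i)) (fun i => g (S i)) env
  end.

Lemma lincomb_add f g env : lincomb (fun i => f i + g i) env = lincomb f env +v lincomb g env.
Proof.
  revert f g; induction env as [|x env IH]; intros f g; simpl.
  - now rewrite vadd_0.
  - rewrite IH, vscal_distr_s, !vadd_assoc. f_equal. rewrite <- !vadd_assoc.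
    f_equal. apply vadd_comm.
Qed.

Lemma lincomb_scal a f env : lincomb (fun i => a * f i) env = a *v lincomb f env.
Proof.
  revert f; induction env as [|x env IH]; intros f; simpl.
  - now rewrite vscal_zero.
  - now rewrite IH, vscal_distr_v, vscal_assoc.
Qed.

Lemma lincomb_ext f g env : coef_agree f g env -> lincomb f env = lincomb g env.
Proof.
  revert f g; induction env as [|x env IH]; intros f g; simpl; [easy|].
  intros [-> H]. now rewrite (IH _ _ H).
Qed.

Lemma lincomb_0 env : lincomb (fun _ => 0) env = vzero.
Proof.
  induction env as [|x env IH]; simpl; [easy|]. now rewrite IH, vscal_0, vadd_0.
Qed.

Lemma lincomb_atom n env :
  lincomb (fun i => if Nat.eqb n i then 1 else 0) env = nth n env vzero.
Proof.
  revert n; induction env as [|x env IH]; intros [|n]; simpl; try easy.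
  - now rewrite lincomb_0, vscal_1, vadd_0.
  - now rewrite IH, vscal_0, vadd_0l.
Qed.

Lemma veval_lincomb e env : veval env e = lincomb (vcoef e) env.
Proof.
  induction e as [n| |e IHe f IHf|e IHe|a e IHe]; simpl.
  - now rewrite lincomb_atom.
  - now rewrite lincomb_0.
  - now rewrite IHe, IHf, <- lincomb_add.
  - rewrite IHe, vopp_scal, <- lincomb_scal. f_equal.
    apply functional_extensionality; intros i; ring.
  - now rewrite IHe, <- lincomb_scal.
Qed.

Lemma veval_eq env e f : coef_agree (vcoef e) (vcoef f) env -> veval env e = veval env f.
Proof. intros H. rewrite !veval_lincomb. now apply lincomb_ext. Qed.

End LinearIdentities.

Ltac vmember x l :=
  lazymatch l with
  | nil => false
  | x :: _ => true
  | _ :: ?l => vmember x l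
  end.
Ltac vatoms t l :=
  lazymatch t with
  | vadd ?a ?b => let l := vatoms a l in vatoms b l
  | vopp ?a => vatoms a l
  | vscal _ ?a => vatoms a l
  | vzero => l
  | _ => lazymatch vmember t l with true => l | false => constr:(t :: l) end
  end.
Ltac vindex x l :=
  lazymatch l with
  | x :: _ => constr:(O)
  | _ :: ?l => let n := vindex x l in constr:(S n)
  end.
Ltac vreify t l :=
  lazymatch t with
  | vadd ?a ?b => let a := vreify a l in let b := vreify b l in constr:(VAdd a b)
  | vopp ?a => let a := vreify a l in constr:(VOpp a)
  | vscal ?r ?a => let a := vreify a l in constr:(VScal r a)
  | vzero => constr:(VZero)
  | _ => let n := vindex t l in constr:(VAtom n)
  end.
Ltac vec_with tac :=
  lazymatch goal with
  | |- @eq (car ?X) ?s ?t =>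
    let l := vatoms s (@nil (car X)) in
    let l := vatoms t l in
    let es := vreify s l in
    let et := vreify t l in
    change (veval l es = veval l et);
    apply veval_eq; simpl; repeat split; tac
  end.
Ltac vec := vec_with ltac:(ring).
Ltac vecf := vec_with ltac:(field; try lra).

(** * Norms and distances *)

Section Norms.
Context {X : Banach}.

Lemma vnorm_0 : vnorm (vzero : X) = 0.
Proof. rewrite <- (vscal_0 vzero), vnorm_scal, Rabs_R0. ring. Qed.

Lemma vnorm_opp (x : X) : vnorm (vopp x) = vnorm x.
Proof. rewrite vopp_scal, vnorm_scal. rewrite Rabs_left by lra. lra. Qed.

Lemma vnorm_pos (x : X) : 0 <= vnorm x.
Proof.
  pose proof (vnorm_tri _ x (vopp x)) as H. rewrite vadd_opp, vnorm_0, vnorm_opp in H. lra.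
Qed.

Lemma vnorm_scal_pos a (x : X) : 0 <= a -> vnorm (a *v x) = a * vnorm x.
Proof. intros. now rewrite vnorm_scal, Rabs_right by lra. Qed.

Lemma vdist_pos (x y : X) : 0 <= vdist x y.
Proof. apply vnorm_pos. Qed.

Lemma vdist_sym (x y : X) : vdist x y = vdist y x.
Proof. unfold vdist. rewrite <- vnorm_opp. f_equal. vec. Qed.

Lemma vdist_refl (x : X) : vdist x x = 0.
Proof. unfold vdist. rewrite vadd_opp. apply vnorm_0. Qed.

Lemma vdist_tri (x y z : X) : vdist x z <= vdist x y + vdist y z.
Proof.
  unfold vdist. replace (x -v z) with ((x -v y) +v (y -v z)) by vec. apply vnorm_tri.
Qed.

Lemma vdist_eq0 (x y : X) : vdist x y <= 0 -> x = y.
Proof.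
  intros H. pose proof (vdist_pos x y).
  assert (E : x -v y = vzero) by (apply vnorm_eq0; unfold vdist in *; lra).
  apply (vadd_cancel _ _ (vopp y)). now rewrite E, vadd_opp.
Qed.

(** The dimension enters through a nonzero vector: it makes the diameter of a ball twice its radius
    and provides a line for the infimum in [beta]. *)
Lemma exists_unit_vector : exists v : X, vnorm v = 1.
Proof.
  destruct (vdim2 X) as (x & y & H).
  assert (Hx : vnorm x <> 0).
  { intros E%vnorm_eq0. destruct (H 1 0); [|lra].
    rewrite E. vec. }
  pose proof (vnorm_pos x).
  exists ((/ vnorm x) *v x). rewrite vnorm_scal_pos; [now field|].
  apply Rlt_le, Rinv_0_lt_compat; lra.
Qed.

End Norms.

(** * Suprema, diameters and beta numbers *)

Lemma sup_R_lub (S : R -> Prop) m :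
  (exists x, S x) -> (forall x, S x -> x <= m) -> is_lub S (sup_R S).
Proof.
  intros Hne Hm. unfold sup_R. apply epsilon_spec.
  destruct (completeness S) as [s Hs]; [|easy|now exists s].
  exists m. exact Hm.
Qed.

Lemma inf_R_le (S : R -> Prop) m x : (forall y, S y -> m <= y) -> S x -> inf_R S <= x.
Proof.
  intros Hm Hx. unfold inf_R.
  destruct (sup_R_lub (fun r => S (- r)) (- m)) as [H _].
  - exists (- x). now rewrite Ropp_involutive.
  - intros y Hy. specialize (Hm _ Hy). lra.
  - enough (- x <= sup_R (fun r => S (- r))) by lra.
    apply H. now rewrite Ropp_involutive.
Qed.

Lemma inf_R_ge (S : R -> Prop) m : (exists x, S x) -> (forall y, S y -> m <= y) -> m <= inf_R S.
Proof.
  intros [x Hx] Hm. unfold inf_R.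
  destruct (sup_R_lub (fun r => S (- r)) (- m)) as [_ H].
  - exists (- x). now rewrite Ropp_involutive.
  - intros y Hy. specialize (Hm _ Hy). lra.
  - enough (sup_R (fun r => S (- r)) <= - m) by lra.
    apply H. intros y Hy. specialize (Hm _ Hy). lra.
Qed.

Lemma inf_R_lt (S : R -> Prop) m s :
  (exists x, S x) -> (forall y, S y -> m <= y) -> inf_R S < s -> exists x, S x /\ x < s.
Proof.
  intros Hne Hm Hs. apply NNPP. intros H.
  assert (s <= inf_R S); [|lra]. apply inf_R_ge; [easy|].
  intros y Hy. apply Rnot_lt_le. intros Hlt. apply H. now exists y.
Qed.

Section Beta.
Context {X : Banach}.

Lemma diam_lub (Q : X -> Prop) c :
  (forall x y, Q x -> Q y -> vdist x y <= c) -> 0 <= c ->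
  is_lub (fun r => r = 0 \/ exists x y, Q x /\ Q y /\ r = vdist x y) (diam Q).
Proof.
  intros Hc H0. apply (sup_R_lub _ c).
  - exists 0. now left.
  - intros r [->|(x & y & Hx & Hy & ->)]; auto.
Qed.

Lemma diam_le (Q : X -> Prop) c :
  (forall x y, Q x -> Q y -> vdist x y <= c) -> 0 <= c -> diam Q <= c.
Proof.
  intros Hc H0. apply (diam_lub Q c Hc H0).
  intros r [->|(x & y & Hx & Hy & ->)]; auto.
Qed.

Lemma vdist_le_diam (Q : X -> Prop) x y : Defs.bounded Q -> Q x -> Q y -> vdist x y <= diam Q.
Proof.
  intros [c Hc] Hx Hy. apply (diam_lub Q c Hc).
  - pose proof (vdist_pos x y). specialize (Hc x y Hx Hy). lra.
  - right. now exists x, y.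
Qed.

Lemma diam_ge0 (Q : X -> Prop) : Defs.bounded Q -> 0 <= diam Q.
Proof.
  intros [c Hc]. apply (diam_lub Q (Rmax c 0)).
  - intros x y Hx Hy. eapply Rle_trans; [now apply Hc|apply Rmax_l].
  - apply Rmax_r.
  - now left.
Qed.

Lemma diam_cball (c : X) (s : R) : 0 <= s -> diam (cball c s) = 2 * s.
Proof.
  intros Hs.
  assert (Hb : forall x y, cball c s x -> cball c s y -> vdist x y <= 2 * s).
  { intros x y Hx Hy. unfold cball in *. pose proof (vdist_tri x c y).
    rewrite (vdist_sym c y) in H. lra. }
  apply Rle_antisym.
  - apply diam_le; [easy|lra].
  - destruct (@exists_unit_vector X) as [v Hv].
    replace (2 * s) with (vdist (c +v s *v v) (c -v s *v v)).
    + apply vdist_le_diam.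
      * now exists (2 * s).
      * unfold cball, vdist. replace (c +v s *v v -v c) with (s *v v) by vec.
        rewrite vnorm_scal_pos, Hv; lra.
      * unfold cball, vdist. replace (c -v s *v v -v c) with (vopp (s *v v)) by vec.
        rewrite vnorm_opp, vnorm_scal_pos, Hv; lra.
    + unfold vdist. replace (c +v s *v v -v (c -v s *v v)) with ((2 * s) *v v) by vec.
      rewrite vnorm_scal_pos, Hv; lra.
Qed.

Lemma dist_line_le (x a v : X) t : dist_line x a v <= vdist x (a +v t *v v).
Proof.
  apply (inf_R_le _ 0).
  - intros r [u ->]. apply vdist_pos.
  - now exists t.
Qed.

Lemma dist_line_lt (x a v : X) s :
  dist_line x a v < s -> exists t, vdist x (a +v t *v v) < s.
Proof.
  intros H. destruct (fun h1 h2 => inf_R_lt _ 0 s h1 h2 H) as (r & [t ->] & Hr).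
  - exists (vdist x (a +v 0 *v v)). now exists 0.
  - intros r [t ->]. apply vdist_pos.
  - now exists t.
Qed.

(** [sup_R] is an unspecified real until its set is known to be bounded. Here the distance to the
    point [a] of the line, at most [vdist c a + s] on the ball, gives the bound. *)
Lemma beta_inner_lub (E : X -> Prop) (c a v : X) s : 0 < s ->
  is_lub (fun r => r = 0 \/
            exists x, E x /\ cball c s x /\ r = dist_line x a v / diam (cball c s))
    (sup_R (fun r => r = 0 \/
            exists x, E x /\ cball c s x /\ r = dist_line x a v / diam (cball c s))).
Proof.
  intros Hs. rewrite diam_cball by lra.
  apply (sup_R_lub _ ((vdist c a + s) / (2 * s))).
  - exists 0. now left.
  - assert (Hi : 0 < / (2 * s)) by (apply Rinv_0_lt_compat; lra).
    pose proof (vdist_pos c a).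
    intros r [->|(x & _ & Hx & ->)].
    + apply Rmult_le_pos; lra.
    + apply Rmult_le_compat_r; [lra|].
      pose proof (dist_line_le x a v 0) as H1.
      replace (a +v 0 *v v) with a in H1 by vec.
      unfold cball in Hx. pose proof (vdist_tri x c a). lra.
Qed.

Lemma beta_ge0 (E : X -> Prop) (c : X) s : 0 < s -> 0 <= beta E (cball c s).
Proof.
  intros Hs. apply inf_R_ge.
  - destruct (@exists_unit_vector X) as [v Hv]. eexists. exists c, v. split; [|reflexivity].
    intros ->. rewrite vnorm_0 in Hv. lra.
  - intros r (a & v & _ & ->). apply (beta_inner_lub E c a v s Hs). now left.
Qed.

(** The infimum over lines need not be attained, hence the strict inequality for [b]. The direction
    is normalized so that differences of parameters are distances on the line. *)
Lemma beta_lt_line (E : X -> Prop) (c : X) s b : 0 < s -> beta E (cball c s) < b ->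
  exists a v : X, vnorm v = 1 /\
    forall x, E x -> vdist x c <= s -> exists t, vdist x (a +v t *v v) < b * (2 * s).
Proof.
  intros Hs Hb.
  destruct (fun h1 h2 => inf_R_lt _ 0 b h1 h2 Hb) as (r & (a & v & Hv & ->) & Hr).
  - destruct (@exists_unit_vector X) as [v Hv]. eexists. exists c, v. split; [|reflexivity].
    intros ->. rewrite vnorm_0 in Hv. lra.
  - intros r (a & v & _ & ->). apply (beta_inner_lub E c a v s Hs). now left.
  - assert (Hn : 0 < vnorm v).
    { destruct (vnorm_pos v) as [|E0]; [easy|]. symmetry in E0.
      now apply vnorm_eq0 in E0. }
    exists a, ((/ vnorm v) *v v). split.
    { rewrite vnorm_scal_pos; [now field; lra|]. now apply Rlt_le, Rinv_0_lt_compat. }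
    intros x Hx Hxc.
    assert (H : dist_line x a v / (2 * s) < b).
    { eapply Rle_lt_trans; [|exact Hr].
      apply (beta_inner_lub E c a v s Hs). right. exists x.
      rewrite diam_cball by lra. easy. }
    apply (Rmult_lt_compat_r (2 * s)) in H; [|lra].
    replace (dist_line x a v / (2 * s) * (2 * s)) with (dist_line x a v) in H by (field; lra).
    destruct (dist_line_lt _ _ _ _ H) as [t Ht].
    exists (t * vnorm v).
    replace (a +v (t * vnorm v) *v (/ vnorm v *v v)) with (a +v t *v v); [easy|].
    vecf.
Qed.

End Beta.

(** * Lists of points and polygonal lines *)

Lemma StronglySorted_app {T : Type} (P : T -> T -> Prop) l1 l2 :
  StronglySorted P (l1 ++ l2) <->
  StronglySorted P l1 /\ StronglySorted P l2 /\ (forall a b, In a l1 -> In b l2 -> P a b).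
Proof.
  induction l1 as [|a l1 IH]; simpl.
  - split; [intros H; repeat split; [constructor|easy|easy]|tauto].
  - split.
    + intros H. apply StronglySorted_inv in H. destruct H as [H Ha].
      rewrite Forall_forall in Ha. apply IH in H. destruct H as (H1 & H2 & H3).
      repeat split.
      * constructor; [easy|]. apply Forall_forall. intros b Hb. apply Ha, in_or_app. now left.
      * easy.
      * intros b c [<-|Hb] Hc; [|now apply H3]. apply Ha, in_or_app. now right.
    + intros (H1 & H2 & H3). apply StronglySorted_inv in H1. destruct H1 as [H1 Ha].
      rewrite Forall_forall in Ha. constructor.
      * apply IH. repeat split; [easy|easy|]. intros b c Hb Hc. apply H3; [now right|easy].
      * apply Forall_forall. intros b Hb. apply in_app_or in Hb.
        destruct Hb; [now apply Ha|]. apply H3; [now left|easy].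
Qed.

Lemma StronglySorted_weaken {T : Type} (P Q : T -> T -> Prop) l :
  (forall a b, In a l -> In b l -> P a b -> Q a b) -> StronglySorted P l -> StronglySorted Q l.
Proof.
  induction l as [|a l IH]; intros H Hl; [constructor|].
  apply StronglySorted_inv in Hl. destruct Hl as [Hl Ha]. rewrite Forall_forall in Ha.
  constructor.
  - apply IH; [|easy]. intros b c Hb Hc. apply H; now right.
  - apply Forall_forall. intros b Hb. apply H; [now left|now right|now apply Ha].
Qed.

Lemma insert_by_key {T : Type} (t : T -> R) a l :
  (forall b, In b l -> t a <> t b) -> StronglySorted (fun a b => t a < t b) l ->
  exists l', Permutation (a :: l) l' /\ StronglySorted (fun a b => t a < t b) l'.
Proof.
  induction l as [|b l IH]; intros Hn Hl.
  - exists [a]. split; [easy|]. repeat constructor.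
  - pose proof Hl as Hl0. apply StronglySorted_inv in Hl. destruct Hl as [Hl Hb].
    rewrite Forall_forall in Hb.
    destruct (Rtotal_order (t a) (t b)) as [Hab|[Hab|Hab]].
    + exists (a :: b :: l). split; [easy|]. constructor; [easy|].
      apply Forall_forall. intros c [<-|Hc]; [easy|]. specialize (Hb c Hc). lra.
    + exfalso. apply (Hn b); [now left|easy].
    + destruct IH as (l' & Hp & Hs); [|easy|].
      { intros c Hc. apply Hn. now right. }
      exists (b :: l'). split.
      * rewrite perm_swap. now constructor.
      * constructor; [easy|]. apply Forall_forall. intros c Hc.
        apply (Permutation_in _ (Permutation_sym Hp)) in Hc.
        destruct Hc as [<-|Hc]; [easy|now apply Hb].
Qed.

Lemma sort_by_key {T : Type} (t : T -> R) l :
  NoDup l -> (forall a b, In a l -> In b l -> a <> b -> t a <> t b) ->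
  exists l', Permutation l l' /\ StronglySorted (fun a b => t a < t b) l'.
Proof.
  induction l as [|a l IH]; intros Hd Ht.
  - exists []. split; [easy|constructor].
  - apply NoDup_cons_iff in Hd. destruct Hd as [Ha Hd].
    destruct IH as (l' & Hp & Hs); [easy| |].
    { intros b c Hb Hc. apply Ht; now right. }
    destruct (insert_by_key t a l') as (l'' & Hp' & Hs'); [|easy|].
    + intros b Hb. apply (Permutation_in _ (Permutation_sym Hp)) in Hb.
      apply Ht; [now left|now right|]. intros ->. contradiction.
    + exists l''. split; [|easy]. rewrite <- Hp'. now constructor.
Qed.

Lemma last_cons {T : Type} (a b : T) l : last (b :: l) a = last l b.
Proof.
  revert a b; induction l as [|c l IH]; intros a b; [easy|].
  change (last (c :: l) a = last (c :: l) b). now rewrite !IH.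
Qed.

Lemma last_in {T : Type} (a : T) l : In (last l a) (a :: l).
Proof.
  revert a; induction l as [|b l IH]; intros a; [now left|].
  rewrite last_cons. right. apply IH.
Qed.

Lemma last_snoc {T : Type} (a b : T) l : last (l ++ [b]) a = b.
Proof. apply last_last. Qed.

Definition follows {T : Type} (l : list T) (a b : T) : Prop :=
  exists l1 l2, l = l1 ++ a :: b :: l2.

Lemma NoDup_split_unique {T : Type} (a : T) l1 l2 l1' l2' :
  NoDup (l1 ++ a :: l2) -> l1 ++ a :: l2 = l1' ++ a :: l2' -> l1 = l1' /\ l2 = l2'.
Proof.
  revert l1'; induction l1 as [|b l1 IH]; intros [|c l1'] Hd E; simpl in *.
  - now injection E as <-.
  - injection E as <- ->. apply NoDup_cons_iff in Hd. destruct Hd as [Hd _].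
    exfalso. apply Hd, in_or_app. right. now left.
  - injection E as -> <-. apply NoDup_cons_iff in Hd. destruct Hd as [Hd _].
    exfalso. apply Hd, in_or_app. right. now left.
  - injection E as <- E. apply NoDup_cons_iff in Hd. destruct Hd as [_ Hd].
    destruct (IH l1' Hd E) as [-> ->]. easy.
Qed.

Lemma follows_in {T : Type} (l : list T) a b : follows l a b -> In a l /\ In b l.
Proof.
  intros (l1 & l2 & ->). split; apply in_or_app; right; simpl; tauto.
Qed.

Lemma follows_neq {T : Type} (l : list T) a b : NoDup l -> follows l a b -> a <> b.
Proof.
  intros Hd (l1 & l2 & ->) <-. apply NoDup_remove_2 in Hd. apply Hd.
  apply in_or_app. right. now left.
Qed.

Lemma follows_next_unique {T : Type} (l : list T) a b b' :
  NoDup l -> follows l a b -> follows l a b' -> b = b'.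
Proof.
  intros Hd (l1 & l2 & ->) (l1' & l2' & E).
  destruct (NoDup_split_unique _ _ _ _ _ Hd E) as [_ E']. now injection E'.
Qed.

Lemma follows_prev_unique {T : Type} (l : list T) a a' b :
  NoDup l -> follows l a b -> follows l a' b -> a = a'.
Proof.
  intros Hd (l1 & l2 & ->) (l1' & l2' & E).
  replace (l1 ++ a :: b :: l2) with ((l1 ++ [a]) ++ b :: l2) in * by now rewrite <- app_assoc.
  replace (l1' ++ a' :: b :: l2') with ((l1' ++ [a']) ++ b :: l2') in E by now rewrite <- app_assoc.
  destruct (NoDup_split_unique _ _ _ _ _ Hd E) as [E' _].
  now apply app_inj_tail in E'.
Qed.

Lemma follows_asym {T : Type} (l : list T) a b : NoDup l -> follows l a b -> ~ follows l b a.
Proof.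
  intros Hd (l1 & l2 & ->) (l1' & l2' & E).
  replace (l1' ++ b :: a :: l2') with ((l1' ++ [b]) ++ a :: l2') in E by now rewrite <- app_assoc.
  destruct (NoDup_split_unique _ _ _ _ _ Hd E) as [-> _].
  rewrite <- app_assoc in Hd. apply NoDup_remove_2 in Hd. apply Hd.
  apply in_or_app. right. right. now left.
Qed.

Inductive subseq {T : Type} : list T -> list T -> Prop :=
| subseq_nil : subseq [] []
| subseq_skip a l l' : subseq l l' -> subseq l (a :: l')
| subseq_keep a l l' : subseq l l' -> subseq (a :: l) (a :: l').

Lemma subseq_empty {T : Type} (l : list T) : subseq [] l.
Proof. induction l; now constructor. Qed.

Lemma subseq_app {T : Type} (l1 l1' l2 l2' : list T) :
  subseq l1 l1' -> subseq l2 l2' -> subseq (l1 ++ l2) (l1' ++ l2').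
Proof. intros H H2. induction H; simpl; [easy|apply subseq_skip|apply subseq_keep]; auto. Qed.

Section Chains.
Context {X : Banach}.

Fixpoint chain (f : X -> X -> R) (l : list X) : R :=
  match l with
  | a :: (b :: _) as l' => f a b + chain f l'
  | _ => 0
  end.

Lemma chain_cons2 f a b l : chain f (a :: b :: l) = f a b + chain f (b :: l).
Proof. reflexivity. Qed.

Lemma chain_split f l1 a l2 : chain f (l1 ++ a :: l2) = chain f (l1 ++ [a]) + chain f (a :: l2).
Proof.
  induction l1 as [|b l1 IH].
  - simpl. ring.
  - destruct l1 as [|c l1].
    + simpl. ring.
    + simpl app in *. rewrite !chain_cons2, IH. ring.
Qed.

Lemma chain_app f a l1 b l2 :
  chain f (a :: l1 ++ b :: l2) = chain f (a :: l1) + f (last l1 a) b + chain f (b :: l2).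
Proof.
  revert a; induction l1 as [|c l1 IH]; intros a.
  - simpl. ring.
  - rewrite last_cons. simpl app. rewrite !chain_cons2, IH. ring.
Qed.

Lemma chain_le_mult f l B :
  (forall a b, In a l -> In b l -> f a b <= B) -> chain f l <= INR (length l - 1) * B.
Proof.
  destruct l as [|a l]; [simpl; lra|].
  revert a; induction l as [|b l IH]; intros a H.
  - simpl. lra.
  - rewrite chain_cons2.
    replace (length (a :: b :: l) - 1)%nat with (S (length (b :: l) - 1)) by (simpl; lia).
    rewrite S_INR. specialize (IH b).
    assert (chain f (b :: l) <= INR (length (b :: l) - 1) * B).
    { apply IH. intros c d Hc Hd. apply H; now right. }
    specialize (H a b). simpl In in H. assert (f a b <= B) by tauto. lra.
Qed.

End Chains.

(** * Polygonal lines close to a line in a smooth space *)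

Section Smooth.
Context {X : Banach}.

(** The bound [K t^p] on the modulus of smoothness, with the supremum unfolded and the denominator
    cleared. *)
Definition power_smooth (K p : R) : Prop :=
  forall x y : X, vnorm x = 1 -> 0 < vnorm y ->
    vnorm (x +v y) + vnorm (x -v y) <= 2 + 2 * K * Rpower (vnorm y) p.

Lemma power_smooth_scaled K p (z h : X) : power_smooth K p -> 0 < vnorm z -> 0 < vnorm h ->
  vnorm (z +v h) + vnorm (z -v h) <= 2 * vnorm z * (1 + K * Rpower (vnorm h / vnorm z) p).
Proof.
  intros H Hz Hh. set (m := vnorm z) in *.
  assert (Hm : 0 < / m) by now apply Rinv_0_lt_compat.
  assert (E : vnorm (/ m *v h) = vnorm h / m).
  { rewrite vnorm_scal_pos by lra. unfold Rdiv. ring. }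
  specialize (H (/ m *v z) (/ m *v h)). rewrite E in H.
  replace (vnorm (z +v h)) with (m * vnorm (/ m *v z +v / m *v h)).
  2:{ rewrite <- vnorm_scal_pos by lra. f_equal. vecf. }
  replace (vnorm (z -v h)) with (m * vnorm (/ m *v z -v / m *v h)).
  2:{ rewrite <- vnorm_scal_pos by lra. f_equal. vecf. }
  assert (H1 : vnorm (/ m *v z) = 1).
  { rewrite vnorm_scal_pos by lra. fold m. field. lra. }
  assert (H2 : 0 < vnorm h / m) by now apply Rmult_lt_0_compat.
  specialize (H H1 H2). apply (Rmult_le_compat_l m) in H; lra.
Qed.

(** The longer leg gives up [(s2 - s1) z] by the triangle inequality; what remains is the symmetric
    pair [s1 z + h], [s1 z - h], to which smoothness applies. *)
Lemma two_segments K p (z h : X) s1 s2 : power_smooth K p -> 0 < s1 <= s2 -> 0 < vnorm z ->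
  0 < vnorm h ->
  vnorm (s1 *v z +v h) + vnorm (s2 *v z -v h) <=
  (s1 + s2) * vnorm z + 2 * (s1 * vnorm z) * K * Rpower (vnorm h / (s1 * vnorm z)) p.
Proof.
  intros H Hs Hz Hh.
  assert (E : vnorm (s1 *v z) = s1 * vnorm z) by (apply vnorm_scal_pos; lra).
  assert (Hp : 0 < s1 * vnorm z) by (apply Rmult_lt_0_compat; lra).
  pose proof (power_smooth_scaled K p (s1 *v z) h H) as H1. rewrite E in H1.
  specialize (H1 Hp Hh).
  assert (H2 : vnorm (s2 *v z -v h) <= (s2 - s1) * vnorm z + vnorm (s1 *v z -v h)).
  { replace (s2 *v z -v h) with ((s2 - s1) *v z +v (s1 *v z -v h)) by vec.
    rewrite <- vnorm_scal_pos by lra. apply vnorm_tri. }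
  lra.
Qed.

Lemma Rpower_nonneg x p : 0 <= Rpower x p.
Proof. unfold Rpower. apply Rlt_le, exp_pos. Qed.

(* With [z] the average velocity from [a] to [e], the two legs are [s1 z + h] and [s2 z - h];
   smoothness makes the first-order contributions of [h] cancel. *)
Lemma three_points K p (a b e o v : X) ta tb te r delta :
  power_smooth K p -> 0 <= K -> 0 <= p -> 0 < r -> 0 < delta <= 1 / 100 -> vnorm v = 1 ->
  vdist a (o +v ta *v v) <= delta * r ->
  vdist b (o +v tb *v v) <= delta * r ->
  vdist e (o +v te *v v) <= delta * r ->
  ta + 2 / 5 * r <= tb -> tb + 2 / 5 * r <= te -> te <= ta + 15 * r ->
  vdist a b + vdist b e <= vdist a e + 32 * K * Rpower 20 p * Rpower delta p * r.
Proof.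
  intros HK K0 p0 Hr Hd Hv Ha Hb He H1 H2 H3.
  set (s1 := tb - ta). set (s2 := te - tb).
  set (z := / (s1 + s2) *v (e -v a)).
  set (h := b -v a -v s1 *v z).
  assert (Hs : 4 / 5 * r <= s1 + s2) by (unfold s1, s2; lra).
  assert (Hdr : delta * r <= 1 / 100 * r) by (apply Rmult_le_compat_r; lra).
  assert (Hdr0 : 0 < delta * r) by (apply Rmult_lt_0_compat; lra).
  assert (Hzv : (s1 + s2) * vnorm (z -v v) <= 2 * (delta * r)).
  { rewrite <- vnorm_scal_pos by lra.
    replace ((s1 + s2) *v (z -v v)) with
      ((e -v (o +v te *v v)) -v (a -v (o +v ta *v v))).
    2:{ unfold z. vec_with ltac:(try (field; lra); try (unfold s1, s2; field; lra)). }
    eapply Rle_trans; [apply vnorm_tri|]. rewrite vnorm_opp. unfold vdist in *. lra. }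
  pose proof (vnorm_pos (z -v v)) as Hzv0.
  (* [2 delta r <= r / 50] against [s1 + s2 >= 4 r / 5]. *)
  assert (Hzv1 : vnorm (z -v v) <= 1 / 40).
  { apply Rnot_lt_le. intros Hc.
    assert ((s1 + s2) * (1 / 40) < (s1 + s2) * vnorm (z -v v)) by (apply Rmult_lt_compat_l; lra).
    lra. }
  assert (Hz : 39 / 40 <= vnorm z <= 41 / 40).
  { pose proof (vnorm_tri _ (z -v v) v) as T1.
    replace (z -v v +v v) with z in T1 by vec.
    pose proof (vnorm_tri _ (v -v z) z) as T2.
    replace (v -v z +v z) with v in T2 by vec.
    replace (vnorm (v -v z)) with (vnorm (z -v v)) in T2.
    - lra.
    - rewrite <- vnorm_opp. f_equal. vec. }
  assert (Hs1 : 2 / 5 * r <= s1 <= 15 * r) by (unfold s1; lra).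
  assert (Hs2 : 2 / 5 * r <= s2 <= 15 * r) by (unfold s2; lra).
  assert (Hh : vnorm h <= 4 * (delta * r)).
  { replace h with ((b -v (o +v tb *v v)) -v (a -v (o +v ta *v v)) -v s1 *v (z -v v)).
    2:{ unfold h. vec_with ltac:(unfold s1; ring). }
    eapply Rle_trans; [apply vnorm_tri|]. rewrite vnorm_opp.
    assert (vnorm (s1 *v (z -v v)) <= 2 * (delta * r)).
    { rewrite vnorm_scal_pos by lra. eapply Rle_trans; [|exact Hzv].
      apply Rmult_le_compat_r; lra. }
    assert (vnorm ((b -v (o +v tb *v v)) -v (a -v (o +v ta *v v))) <= 2 * (delta * r)).
    { eapply Rle_trans; [apply vnorm_tri|]. rewrite vnorm_opp. unfold vdist in *. lra. }
    lra. }
  assert (Eu : vdist a b = vnorm (s1 *v z +v h)).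
  { rewrite vdist_sym. unfold vdist. f_equal. unfold h. vec. }
  assert (Ew : vdist b e = vnorm (s2 *v z -v h)).
  { rewrite vdist_sym. unfold vdist. f_equal. unfold h, z. vec_with ltac:(field; lra). }
  assert (Ea : vdist a e = (s1 + s2) * vnorm z).
  { rewrite <- vnorm_scal_pos by lra. rewrite vdist_sym. unfold vdist. f_equal.
    unfold z. vec_with ltac:(field; lra). }
  assert (Hpos : 0 <= 32 * K * Rpower 20 p * Rpower delta p * r).
  { repeat apply Rmult_le_pos; try lra; apply Rpower_nonneg. }
  (* [power_smooth] speaks of nonzero increments only. If [h] vanishes, [b] lies on the segment from
     [a] to [e] and the lengths add up exactly. *)
  destruct (Req_dec (vnorm h) 0) as [E0|E0].
  - apply vnorm_eq0 in E0.
    assert (Eu' : vdist a b = s1 * vnorm z).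
    { rewrite Eu, E0, vadd_0. apply vnorm_scal_pos. lra. }
    assert (Ew' : vdist b e = s2 * vnorm z).
    { rewrite Ew, E0. rewrite <- vnorm_scal_pos by lra. f_equal. vec. }
    lra.
  - assert (Hh0 : 0 < vnorm h) by (pose proof (vnorm_pos h); lra).
    (* To be used for the shorter leg, whichever it is. The [20] comes from [vnorm h <= 4 delta r]
       against a leg of at least [(2/5) (39/40) r], the [32] from twice a leg of at most
       [15 (41/40) r]. *)
    assert (Herr : forall s, 2 / 5 * r <= s <= 15 * r ->
      2 * (s * vnorm z) * K * Rpower (vnorm h / (s * vnorm z)) p <=
      32 * K * Rpower 20 p * Rpower delta p * r).
    { intros s Hs'.
      assert (Hsz : 2 / 5 * r * (39 / 40) <= s * vnorm z) by (apply Rmult_le_compat; lra).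
      assert (Hsz2 : s * vnorm z <= 15 * r * (41 / 40)) by (apply Rmult_le_compat; lra).
      assert (Hle : vnorm h / (s * vnorm z) <= 20 * delta).
      { apply (Rmult_le_reg_r (s * vnorm z)); [lra|].
        replace (vnorm h / (s * vnorm z) * (s * vnorm z)) with (vnorm h) by (field; lra).
        assert (20 * delta * (2 / 5 * r * (39 / 40)) <= 20 * delta * (s * vnorm z))
          by (apply Rmult_le_compat_l; lra).
        lra. }
      assert (Hl0 : 0 < vnorm h / (s * vnorm z)).
      { apply Rmult_lt_0_compat; [easy|]. apply Rinv_0_lt_compat. lra. }
      assert (HR : Rpower (vnorm h / (s * vnorm z)) p <= Rpower 20 p * Rpower delta p).
      { rewrite Rpower_mult_distr by lra. apply Rle_Rpower_l; lra. }
      replace (32 * K * Rpower 20 p * Rpower delta p * r) with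
        ((32 * r) * K * (Rpower 20 p * Rpower delta p)) by ring.
      apply Rmult_le_compat.
      - repeat apply Rmult_le_pos; lra.
      - apply Rpower_nonneg.
      - apply Rmult_le_compat_r; lra.
      - exact HR. }
    rewrite Eu, Ew, Ea. destruct (Rle_lt_dec s1 s2) as [Hle|Hle].
    + pose proof (two_segments K p z h s1 s2 HK) as HT. specialize (Herr s1 Hs1). lra.
    + pose proof (two_segments K p z (vopp h) s2 s1 HK) as HT. specialize (Herr s2 Hs2).
      rewrite vnorm_opp in HT.
      replace (s1 *v z -v vopp h) with (s1 *v z +v h) in HT by vec. lra.
Qed.

(** The second vertex is removed again and again by [three_points], applied to the first, second and
    last vertex. Each removal advances the parameter by at least [2/5 r], so its error [32 (...) r]
    is at most [80 (...)] times the advance, and the sum telescopes: the bound depends on the extent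
    of the polygon and not on the number of its vertices. *)
Lemma polygon_near_line K p (o v : X) (t : X -> R) r delta a l :
  power_smooth K p -> 0 <= K -> 0 <= p -> 0 < r -> 0 < delta <= 1 / 100 -> vnorm v = 1 ->
  (forall z, In z (a :: l) -> vdist z (o +v t z *v v) <= delta * r) ->
  StronglySorted (fun y z => t y + 2 / 5 * r <= t z) (a :: l) ->
  t (last l a) <= t a + 15 * r ->
  chain vdist (a :: l) <= vdist a (last l a) +
    80 * K * Rpower 20 p * Rpower delta p * (t (last l a) - t a).
Proof.
  intros HK K0 p0 Hr Hd Hv.
  set (B := 80 * K * Rpower 20 p * Rpower delta p).
  assert (HB : 0 <= B).
  { unfold B. repeat apply Rmult_le_pos; try lra; apply Rpower_nonneg. }
  revert a; induction l as [|b l IH]; intros a Ht Hs Hl.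
  - simpl. rewrite vdist_refl. lra.
  - rewrite last_cons in *. rewrite chain_cons2.
    apply StronglySorted_inv in Hs. destruct Hs as [Hs Ha]. rewrite Forall_forall in Ha.
    assert (Hab := Ha b (or_introl eq_refl)).
    assert (HB' : B * (2 / 5 * r) <= B * (t b - t a)) by (apply Rmult_le_compat_l; lra).
    assert (Hbl : t b <= t (last l b)).
    { destruct (last_in b l) as [<-|Hin]; [lra|].
      apply StronglySorted_inv in Hs. destruct Hs as [_ Hb]. rewrite Forall_forall in Hb.
      specialize (Hb _ Hin). lra. }
    specialize (IH b). assert (IH' := IH (fun z Hz => Ht z (or_intror Hz)) Hs ltac:(lra)).
    destruct l as [|c l].
    + simpl in *. rewrite vdist_refl in IH'.
      assert (0 <= B * (t b - t a)) by (apply Rmult_le_pos; lra). lra.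
    + assert (Hin : In (last (c :: l) b) (c :: l)) by (rewrite last_cons; apply last_in).
      set (e := last (c :: l) b) in *.
      apply StronglySorted_inv in Hs. destruct Hs as [_ Hb]. rewrite Forall_forall in Hb.
      specialize (Hb e Hin).
      pose proof (three_points K p a b e o v (t a) (t b) (t e) r delta HK K0 p0 Hr Hd Hv) as T.
      specialize (T (Ht a ltac:(now left)) (Ht b ltac:(right; now left))
                    (Ht e ltac:(right; now right)) Hab Hb Hl).
      assert (E : 32 * K * Rpower 20 p * Rpower delta p * r = B * (2 / 5 * r)) by (unfold B; field).
      lra.
Qed.

End Smooth.
Arguments power_smooth X K p : clear implicits.

(** * Refining an ordering of a net *)

(* Emptiness of the lune makes [a] and [b] neighbours whenever [V] is nearly collinear there,
   without reference to any line. *)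
Definition adjacent {X : Banach} (V : list X) (s : R) (a b : X) : Prop :=
  vdist a b <= 12 * s /\
  forall z, In z V -> ~ (vdist a z < vdist a b /\ vdist z b < vdist a b).

(* A link across a gap counts for half its length, plus a reserve of [3 s] for each of its ends;
   at length [12 s] the two prices coincide. *)
Definition link {X : Banach} (V : list X) (s : R) (a b : X) : R :=
  if excluded_middle_informative (adjacent V s a b) then vdist a b else vdist a b / 2 + 6 * s.

Definition sumg {T : Type} (g : T -> R) (l : list T) : R :=
  fold_right (fun y acc => g y + acc) 0 l.

Lemma sumg_app {T : Type} (g : T -> R) l1 l2 : sumg g (l1 ++ l2) = sumg g l1 + sumg g l2.
Proof. induction l1 as [|a l1 IH]; simpl; [ring|]. rewrite IH. ring. Qed.

Lemma sumg_perm {T : Type} (g : T -> R) l1 l2 : Permutation l1 l2 -> sumg g l1 = sumg g l2.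
Proof. induction 1; simpl; lra. Qed.

Lemma sumg_ge0 {T : Type} (g : T -> R) l : (forall y, In y l -> 0 <= g y) -> 0 <= sumg g l.
Proof.
  induction l as [|a l IH]; simpl; intros H; [lra|].
  assert (0 <= g a) by auto. assert (0 <= sumg g l) by auto. lra.
Qed.

Lemma sumg_in {T : Type} (g : T -> R) l y :
  (forall y, In y l -> 0 <= g y) -> In y l -> g y <= sumg g l.
Proof.
  induction l as [|a l IH]; simpl; intros H; [easy|].
  assert (0 <= g a) by auto. assert (0 <= sumg g l) by (apply sumg_ge0; auto).
  intros [->|Hy]; [lra|]. assert (g y <= sumg g l) by auto. lra.
Qed.

Lemma sumg_length {T : Type} (g : T -> R) l :
  (forall y, In y l -> 1 <= g y) -> INR (length l) <= sumg g l.
Proof.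
  induction l as [|a l IH]; intros H; [simpl; lra|].
  change (length (a :: l)) with (S (length l)). rewrite S_INR. simpl.
  assert (1 <= g a) by (apply H; now left).
  assert (INR (length l) <= sumg g l) by (apply IH; intros; apply H; now right). lra.
Qed.

Section Links.
Context {X : Banach}.

Lemma link_le_gap (V : list X) s a b : link V s a b <= vdist a b / 2 + 6 * s.
Proof.
  unfold link. destruct excluded_middle_informative as [[H _]|_]; lra.
Qed.

Lemma link_ge_half (V : list X) s a b : 0 <= s -> vdist a b / 2 <= link V s a b.
Proof.
  intros Hs. pose proof (vdist_pos a b).
  unfold link. destruct excluded_middle_informative as [[Hl _]|_]; lra.
Qed.

Lemma link_adjacent (V : list X) s a b : adjacent V s a b -> link V s a b = vdist a b.
Proof. intros H. unfold link. now destruct excluded_middle_informative. Qed.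

Lemma link_not_adjacent (V : list X) s a b :
  ~ adjacent V s a b -> link V s a b = vdist a b / 2 + 6 * s.
Proof. intros H. unfold link. now destruct excluded_middle_informative. Qed.

(** An empty lune leaves only length as an obstacle to adjacency, and beyond [12 s] half of the
    length covers the reserve. *)
Lemma link_le_vdist (V : list X) s a b :
  (forall z, In z V -> ~ (vdist a z < vdist a b /\ vdist z b < vdist a b)) ->
  link V s a b <= vdist a b.
Proof.
  intros H. unfold link. destruct excluded_middle_informative as [_|Hn]; [lra|].
  destruct (Rle_lt_dec (vdist a b) (12 * s)); [|lra].
  exfalso. apply Hn. now split.
Qed.

End Links.

(** * Charts: coordinates on the fine net [LY] near a point of the coarse net [LX] *)

Section Charts.
Context {X : Banach}.
Variables (LX LY : list X) (r : R) (pr : X -> X).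
Hypothesis r_pos : 0 < r.
Hypothesis LX_incl : forall x, In x LX -> In x LY.
Hypothesis LX_sep : forall x y, In x LX -> In y LX -> x <> y -> r <= vdist x y.
Hypothesis LY_sep : forall x y, In x LY -> In y LY -> x <> y -> r / 2 <= vdist x y.
Hypothesis pr_in : forall y, In y LY -> In (pr y) LX.
Hypothesis pr_near : forall y, In y LY -> vdist y (pr y) < r.
Hypothesis pr_min : forall y x, In y LY -> In x LX -> vdist y (pr y) <= vdist y x.

Lemma pr_id x : In x LX -> pr x = x.
Proof.
  intros Hx. symmetry. apply vdist_eq0.
  pose proof (pr_min x x (LX_incl x Hx) Hx) as H. now rewrite vdist_refl in H.
Qed.

(** The coordinate [t] is any choice of parameters of nearby points on the line, so it is determined
    only up to [2 delta r]. It is constrained only within [40 r] of [x]. *)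
Definition flat_chart (x : X) (delta : R) (t : X -> R) : Prop :=
  0 < delta <= 1 / 100 /\
  exists o v : X, vnorm v = 1 /\
    forall z, In z LY -> vdist z x <= 40 * r -> vdist z (o +v t z *v v) <= delta * r.

Definition near (x z : X) : Prop := In z LY /\ vdist z x <= 40 * r.

Lemma chart_opp x delta t : flat_chart x delta t -> flat_chart x delta (fun z => - t z).
Proof.
  intros (Hd & o & v & Hv & H). split; [easy|]. exists o, (vopp v).
  rewrite vnorm_opp. split; [easy|]. intros z Hz Hzx.
  replace (o +v (- t z) *v vopp v) with (o +v t z *v v) by vec. auto.
Qed.

(** The error is [2 delta r <= r / 50]. Inequalities and a disjunction replace the absolute value,
    so that [iso] turns questions of order into linear arithmetic by cases. *)
Lemma chart_iso x delta t a b : flat_chart x delta t -> near x a -> near x b ->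
  (t a - t b <= vdist a b + r / 50 /\ t b - t a <= vdist a b + r / 50) /\
  (vdist a b <= t a - t b + r / 50 \/ vdist a b <= t b - t a + r / 50).
Proof.
  intros (Hd & o & v & Hv & H) [Ha Hax] [Hb Hbx].
  assert (Hdr : delta * r <= 1 / 100 * r) by (apply Rmult_le_compat_r; lra).
  assert (H1 := H a Ha Hax). assert (H2 := H b Hb Hbx).
  assert (E : vdist (o +v t a *v v) (o +v t b *v v) = Rabs (t a - t b)).
  { unfold vdist. replace (o +v t a *v v -v (o +v t b *v v)) with ((t a - t b) *v v) by vec.
    rewrite vnorm_scal, Hv. ring. }
  pose proof (vdist_tri (o +v t a *v v) a (o +v t b *v v)) as T1.
  pose proof (vdist_tri a b (o +v t b *v v)) as T2.
  rewrite (vdist_sym _ a) in T1.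
  pose proof (vdist_tri a (o +v t a *v v) b) as T3.
  pose proof (vdist_tri (o +v t a *v v) (o +v t b *v v) b) as T4.
  rewrite (vdist_sym (o +v t b *v v) b) in T4.
  rewrite E in *. unfold Rabs in *. destruct Rcase_abs; lra.
Qed.

Ltac iso H a b :=
  let H1 := fresh "I" in
  pose proof (chart_iso _ _ _ a b H) as H1;
  (destruct H1 as [[? ?] [?|?]]; [assumption|assumption| |]).

Lemma chart_inj x delta t a b : flat_chart x delta t -> near x a -> near x b -> a <> b ->
  t a <> t b.
Proof.
  intros H Ha Hb Hab E. pose proof (LY_sep a b (proj1 Ha) (proj1 Hb) Hab).
  iso H a b; lra.
Qed.

(** The separation [r / 2] less the chart error [r / 50] leaves [0.48 r]. *)
Lemma chart_gap x delta t a b : flat_chart x delta t -> near x a -> near x b -> t a < t b ->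
  t a + 2 / 5 * r <= t b.
Proof.
  intros H Ha Hb Hab. assert (Hn : a <> b) by (intros ->; lra).
  pose proof (LY_sep a b (proj1 Ha) (proj1 Hb) Hn).
  iso H a b; lra.
Qed.

(** On a line the nearest-point cells are intervals, in the order of their centres. Points of
    different cells in the wrong order would both be close to the midpoint of the two centres, and
    so closer to each other than [r / 2]. *)
Lemma territory_order x delta t y z : flat_chart x delta t ->
  near x y -> near x z -> near x (pr y) -> near x (pr z) ->
  t (pr y) < t (pr z) -> t y < t z.
Proof.
  intros H Hy Hz Hpy Hpz Hlt.
  assert (Hn : y <> z) by (intros ->; lra).
  assert (Hn' : pr y <> pr z) by (intros E; rewrite E in *; lra).
  pose proof (LY_sep y z (proj1 Hy) (proj1 Hz) Hn).
  pose proof (LX_sep _ _ (pr_in y (proj1 Hy)) (pr_in z (proj1 Hz)) Hn').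
  pose proof (pr_min y (pr z) (proj1 Hy) (pr_in z (proj1 Hz))).
  pose proof (pr_min z (pr y) (proj1 Hz) (pr_in y (proj1 Hy))).
  iso H y z; try lra.
  all: iso H (pr y) (pr z); try lra.
  all: iso H y (pr y); try lra; iso H y (pr z); try lra.
  all: iso H z (pr y); try lra; iso H z (pr z); try lra.
Qed.

(** With [between_lune]: in any chart the lune of two points contains just the points between them.
    This translates adjacency into order. *)
Lemma lune_between x delta t a b z : flat_chart x delta t ->
  near x a -> near x b -> near x z -> t a < t b ->
  vdist a z < vdist a b -> vdist z b < vdist a b -> t a < t z < t b.
Proof.
  intros H Ha Hb Hz Hlt H1 H2.
  assert (Hza : z <> a) by (intros ->; lra).
  assert (Hzb : z <> b) by (intros ->; lra).
  pose proof (LY_sep z a (proj1 Hz) (proj1 Ha) Hza).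
  pose proof (LY_sep z b (proj1 Hz) (proj1 Hb) Hzb).
  iso H a b; [lra|].
  rewrite (vdist_sym z a) in *.
  iso H a z; iso H z b; lra.
Qed.

Lemma between_lune x delta t a b z : flat_chart x delta t ->
  near x a -> near x b -> near x z -> t a < t z < t b ->
  vdist a z < vdist a b /\ vdist z b < vdist a b.
Proof.
  intros H Ha Hb Hz Hlt.
  pose proof (chart_gap x delta t a z H Ha Hz (proj1 Hlt)).
  pose proof (chart_gap x delta t z b H Hz Hb (proj2 Hlt)).
  iso H a b; [lra|]. iso H a z; iso H z b; lra.
Qed.

Lemma near_LX x z : In z LX -> vdist z x <= 40 * r -> near x z.
Proof. intros Hz Hd. split; auto. Qed.

Lemma near_self x : In x LX -> near x x.
Proof. intros Hx. split; auto. rewrite vdist_refl. lra. Qed.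

(** If both neighbours were on the same side of [x], the closer one would lie between [x] and the
    other, hence in a lune that is empty. *)
Lemma adjacent_opposite x delta t p q : flat_chart x delta t ->
  In x LX -> In p LX -> In q LX -> p <> x -> q <> x -> p <> q ->
  adjacent LX r p x -> adjacent LX r x q -> t p < t x -> t x < t q.
Proof.
  intros H Hx Hp Hq Hpx Hqx Hpq [Hpl Hpe] [Hql Hqe] Hlt.
  rewrite vdist_sym in Hql.
  assert (Nx := near_self x Hx).
  assert (Np : near x p) by (apply near_LX; [easy|lra]).
  assert (Nq : near x q) by (apply near_LX; [easy|lra]).
  assert (t q <> t x) by (apply (chart_inj x delta t); auto).
  assert (t p <> t q) by (apply (chart_inj x delta t); auto).
  destruct (Rlt_le_dec (t x) (t q)) as [|Hle]; [easy|exfalso].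
  destruct (Rlt_le_dec (t p) (t q)) as [Hlt'|Hle'].
  - destruct (between_lune x delta t p x q H Np Nx Nq); [lra|].
    apply (Hpe q Hq). easy.
  - destruct (between_lune x delta t q x p H Nq Nx Np); [lra|].
    apply (Hqe p Hp). rewrite (vdist_sym x p), (vdist_sym p q), (vdist_sym x q). easy.
Qed.

(** The two charts come from unrelated lines. Once they order [a] and [b] alike, the distances of
    [c] to [a] and [b], nearly preserved by both, decide on which side of [a] it lies. *)
Lemma order_agree_right x1 d1 t1 x2 d2 t2 a b c :
  flat_chart x1 d1 t1 -> flat_chart x2 d2 t2 ->
  near x1 a -> near x1 b -> near x1 c -> near x2 a -> near x2 b -> near x2 c ->
  a <> c -> b <> c ->
  t1 a < t1 b -> t2 a < t2 b -> t1 a < t1 c -> t2 a < t2 c.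
Proof.
  intros H1 H2 A1 B1 C1 A2 B2 C2 Nac Nbc L1 L2 L3.
  pose proof (LY_sep _ _ (proj1 A1) (proj1 C1) Nac).
  pose proof (LY_sep _ _ (proj1 B1) (proj1 C1) Nbc).
  pose proof (chart_gap _ _ _ _ _ H1 A1 B1 L1).
  pose proof (chart_gap _ _ _ _ _ H2 A2 B2 L2).
  iso H1 a b; try lra. iso H2 a b; try lra.
  iso H2 a c; try lra. iso H1 a c; try lra.
  iso H1 b c; iso H2 b c; lra.
Qed.

Lemma order_agree_left x1 d1 t1 x2 d2 t2 a b c :
  flat_chart x1 d1 t1 -> flat_chart x2 d2 t2 ->
  near x1 a -> near x1 b -> near x1 c -> near x2 a -> near x2 b -> near x2 c ->
  a <> c -> b <> c ->
  t1 a < t1 b -> t2 a < t2 b -> t1 c < t1 b -> t2 c < t2 b.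
Proof.
  intros H1 H2 A1 B1 C1 A2 B2 C2 Nac Nbc L1 L2 L3.
  pose proof (order_agree_right _ _ _ _ _ _ b a c (chart_opp _ _ _ H1) (chart_opp _ _ _ H2)
    B1 A1 C1 B2 A2 C2 Nbc Nac). simpl in *. lra.
Qed.

(* Nothing of [LY] lies between consecutive points of [S], so every link of [S] has price at most
   its length. *)
Lemma chain_link_le_length x delta t a l : flat_chart x delta t ->
  (forall z, In z (a :: l) -> In z LY /\ vdist z x <= 14 * r) ->
  StronglySorted (fun y z => t y < t z) (a :: l) ->
  (forall z, near x z -> t a < t z < t (last l a) -> In z (a :: l)) ->
  t (last l a) <= t a + 15 * r ->
  chain (link LY (r / 2)) (a :: l) <= chain vdist (a :: l).
Proof.
  intros H. revert a. induction l as [|b l IH]; intros a Hin Hs Hc Hl; [simpl; lra|].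
  rewrite !chain_cons2, last_cons in *.
  apply StronglySorted_inv in Hs. destruct Hs as [Hs Ha]. rewrite Forall_forall in Ha.
  pose proof (Ha b (or_introl eq_refl)) as Hab.
  assert (Hbl : t b <= t (last l b)).
  { destruct (last_in b l) as [<-|Hil]; [lra|].
    apply StronglySorted_inv in Hs. destruct Hs as [_ Hb]. rewrite Forall_forall in Hb.
    specialize (Hb _ Hil). lra. }
  apply Rplus_le_compat.
  - destruct (Hin a ltac:(now left)) as [Hay Hax].
    destruct (Hin b ltac:(right; now left)) as [Hby Hbx].
    apply link_le_vdist.
    intros z Hz [Hz1 Hz2].
    assert (Na : near x a) by (split; [easy|lra]).
    assert (Nb : near x b) by (split; [easy|lra]).
    (* A point of the lune is within [14 r + 15.02 r] of [x], where the chart is still valid. *)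
    assert (Nz : near x z).
    { split; [easy|]. pose proof (vdist_tri z a x). rewrite (vdist_sym z a) in *.
      assert (vdist a b <= 15 * r + r / 50) by (iso H a b; lra). lra. }
    pose proof (lune_between x delta t a b z H Na Nb Nz Hab Hz1 Hz2) as Hzt.
    destruct (Hc z Nz ltac:(lra)) as [->|[->|Hz3]]; [lra|lra|].
    apply StronglySorted_inv in Hs. destruct Hs as [_ Hb]. rewrite Forall_forall in Hb.
    specialize (Hb _ Hz3). lra.
  - apply IH; [|easy| |lra].
    + intros z Hz. apply Hin. now right.
    + intros z Nz Hz. destruct (Hc z Nz ltac:(lra)) as [->|Hz']; [lra|easy].
Qed.

(** [1200 = 80 * 15]: the error of [polygon_near_line] per unit of extent, times an extent of at
    most [15 r]. *)
Lemma flat_segment_cost K p x delta t a l :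
  power_smooth X K p -> 0 <= K -> 0 <= p -> flat_chart x delta t ->
  (forall z, In z (a :: l) -> In z LY /\ vdist z x <= 14 * r) ->
  StronglySorted (fun y z => t y < t z) (a :: l) ->
  (forall z, near x z -> t a < t z < t (last l a) -> In z (a :: l)) ->
  t (last l a) <= t a + 15 * r ->
  chain (link LY (r / 2)) (a :: l) <=
    vdist a (last l a) + 1200 * K * Rpower 20 p * Rpower delta p * r.
Proof.
  intros HK K0 p0 H Hin Hs Hc Hl.
  eapply Rle_trans; [now apply (chain_link_le_length x delta t)|].
  destruct H as (Hd & o & v & Hv & H).
  eapply Rle_trans; [apply (polygon_near_line K p o v t r delta); try assumption|].
  - intros z Hz. apply Hin in Hz. apply H; [easy|]. lra.
  - eapply StronglySorted_weaken; [|exact Hs]. intros y z Hy Hz Hyz.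
    apply Hin in Hy. apply Hin in Hz.
    apply (chart_gap x delta t); try easy.
    + split; [easy|]. now exists o, v.
    + split; [easy|]. lra.
    + split; [easy|]. lra.
  - assert (0 <= 80 * K * Rpower 20 p * Rpower delta p).
    { repeat apply Rmult_le_pos; try lra; apply Rpower_nonneg. }
    assert (80 * K * Rpower 20 p * Rpower delta p * (t (last l a) - t a) <=
            80 * K * Rpower 20 p * Rpower delta p * (15 * r)) by (apply Rmult_le_compat_l; lra).
    lra.
Qed.

(** * Blocks: the points of the fine net nearest to one point of the coarse net *)

Variables (K p : R) (g : X -> R).
Hypothesis K_ge0 : 0 <= K.
Hypothesis p_ge0 : 0 <= p.
Hypothesis smooth : power_smooth X K p.
Hypothesis g_ge0 : forall y, In y LY -> 0 <= g y.
Hypothesis LX_nodup : NoDup LX.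
Hypothesis LY_nodup : NoDup LY.
Hypothesis heavy_or_flat : forall y, In y LY -> 1 <= g y \/
  exists delta (o v : X), 0 < delta <= 1 / 100 /\ vnorm v = 1 /\ Rpower delta p <= g y /\
    forall z, In z LY -> vdist z y <= 41 * r -> exists s, vdist z (o +v s *v v) <= delta * r.

(** One flat point [y] suffices for the whole block of [x]: as [vdist y x < r], the line at [y] is
    valid within [41 r] of [y] and so within [40 r] of [x], and [g y] pays for it. If there is no
    such [y], every point of the block weighs at least [1]. *)
Definition good (x : X) : Prop :=
  exists delta t y, flat_chart x delta t /\ In y LY /\ pr y = x /\ Rpower delta p <= g y.

Lemma good_or_heavy x : good x \/ (forall y, In y LY -> pr y = x -> 1 <= g y).
Proof.
  destruct (classic (forall y, In y LY -> pr y = x -> 1 <= g y)) as [|Hn]; [now right|left].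
  apply not_all_ex_not in Hn. destruct Hn as [y Hn].
  apply imply_to_and in Hn. destruct Hn as [Hy Hn].
  apply imply_to_and in Hn. destruct Hn as [Hp Hn].
  destruct (heavy_or_flat y Hy) as [|(delta & o & v & Hd & Hv & Hg & H)]; [easy|].
  exists delta, (fun z => epsilon (inhabits 0) (fun s => vdist z (o +v s *v v) <= delta * r)), y.
  repeat split; try easy; try lra.
  exists o, v. split; [easy|]. intros z Hz Hzx.
  apply (epsilon_spec (inhabits 0) (fun s => vdist z (o +v s *v v) <= delta * r)).
  apply H; [easy|]. pose proof (pr_near y Hy) as H1. rewrite Hp, vdist_sym in H1.
  pose proof (vdist_tri z x y). lra.
Qed.

(* [L ++ x :: R] lists the points of [LY] whose nearest point in [LX] is [x], in the order in
   which the refined ordering traverses them; it is oriented so that [R] faces the successor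
   and [L] the predecessor of [x] when they are adjacent to [x]. *)
Definition block (x : X) (prev next : X -> Prop) (L R : list X) : Prop :=
  NoDup (L ++ x :: R) /\
  (forall y, In y (L ++ x :: R) <-> In y LY /\ pr y = x) /\
  (good x -> exists delta t, flat_chart x delta t /\ Rpower delta p <= sumg g (L ++ x :: R) /\
    StronglySorted (fun y z => t y < t z) (L ++ x :: R) /\
    (forall q, next q -> adjacent LX r x q -> t x < t q) /\
    (forall q, prev q -> adjacent LX r q x -> t q < t x)).

Lemma adjacent_near x q : In q LX -> adjacent LX r x q -> near x q.
Proof.
  intros Hq [Hd _]. apply near_LX; [easy|]. rewrite vdist_sym. lra.
Qed.

Lemma adjacent_sym (V : list X) s a b : adjacent V s a b -> adjacent V s b a.
Proof.
  intros [H1 H2]. split; [now rewrite vdist_sym|].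
  intros z Hz [H3 H4]. apply (H2 z Hz).
  rewrite (vdist_sym a z), (vdist_sym z b), (vdist_sym a b). easy.
Qed.

(** One orientation has to suit both neighbours. The side of the predecessor, if that is adjacent,
    and otherwise that of the successor fixes the sign [e]; if both are adjacent,
    [adjacent_opposite] puts the successor on the other side. *)
Lemma oriented_chart x (prev next : X -> Prop) : In x LX ->
  (forall q, next q \/ prev q -> In q LX /\ q <> x) ->
  (forall q q', next q -> next q' -> q = q') ->
  (forall q q', prev q -> prev q' -> q = q') ->
  (forall q q', next q -> prev q' -> q <> q') ->
  good x -> exists delta t y, flat_chart x delta t /\ In y LY /\ pr y = x /\
    Rpower delta p <= g y /\
    (forall q, next q -> adjacent LX r x q -> t x < t q) /\
    (forall q, prev q -> adjacent LX r q x -> t q < t x).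
Proof.
  intros Hx Hin Hn Hp Hnp (delta & t & y & Hc & Hy & Hpy & Hg).
  assert (Hne : forall q, In q LX -> q <> x -> near x q -> t q <> t x).
  { intros q Hq Hqx Nq. apply (chart_inj x delta t); auto. now apply near_self. }
  assert (Hflip : forall e, (e = 1 \/ e = -1) -> flat_chart x delta (fun z => e * t z)).
  { intros e [-> | -> ].
    - destruct Hc as (Hd & o & v & Hv & H). split; [easy|]. exists o, v. split; [easy|].
      intros z. rewrite Rmult_1_l. apply H.
    - replace (fun z => -1 * t z) with (fun z => - t z); [now apply chart_opp|].
      apply functional_extensionality; intros; ring. }
  enough (Ho : exists e, (e = 1 \/ e = -1) /\
    (forall q, next q -> adjacent LX r x q -> e * t x < e * t q) /\
    (forall q, prev q -> adjacent LX r q x -> e * t q < e * t x)).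
  { destruct Ho as (e & He & H1 & H2). exists delta, (fun z => e * t z), y.
    split; [now apply Hflip|]. repeat split; auto. }
  destruct (classic (exists q, prev q /\ adjacent LX r q x)) as [(q & Hq & Aq)|Hno].
  - destruct (Hin q (or_intror Hq)) as [Hqx Hqn].
    assert (Nq : near x q) by (now apply adjacent_near; [|apply adjacent_sym]).
    pose proof (Hne q Hqx Hqn Nq) as Htq.
    assert (He : exists e, (e = 1 \/ e = -1) /\ e * t q < e * t x).
    { destruct (Rtotal_order (t q) (t x)) as [H|[H|H]]; [exists 1|easy|exists (-1)];
        split; auto; lra. }
    destruct He as (e & He & Hlt). exists e. split; [easy|]. split.
    + intros q' Hq' Aq'. destruct (Hin q' (or_introl Hq')) as [Hqx' Hqn'].
      apply (adjacent_opposite x delta (fun z => e * t z) q q'); auto.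
      intros ->. now apply (Hnp q' q').
    + intros q' Hq' _. now rewrite (Hp q' q).
  - destruct (classic (exists q, next q /\ adjacent LX r x q)) as [(q & Hq & Aq)|Hno'].
    + destruct (Hin q (or_introl Hq)) as [Hqx Hqn].
      assert (Nq : near x q) by now apply adjacent_near.
      pose proof (Hne q Hqx Hqn Nq) as Htq.
      assert (He : exists e, (e = 1 \/ e = -1) /\ e * t x < e * t q).
      { destruct (Rtotal_order (t q) (t x)) as [H|[H|H]]; [exists (-1)|easy|exists 1];
          split; auto; lra. }
      destruct He as (e & He & Hlt). exists e. split; [easy|]. split.
      * intros q' Hq' _. now rewrite (Hn q' q).
      * intros q' Hq' Aq'. exfalso. apply Hno. now exists q'.
    + exists 1. split; [now left|]. split.
      * intros q' Hq' Aq'. exfalso. apply Hno'. now exists q'.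
      * intros q' Hq' Aq'. exfalso. apply Hno. now exists q'.
Qed.

Definition territory (x : X) : list X :=
  filter (fun y => if excluded_middle_informative (pr y = x) then true else false) LY.

Lemma territory_in x y : In y (territory x) <-> In y LY /\ pr y = x.
Proof.
  unfold territory. rewrite filter_In. destruct excluded_middle_informative; intuition easy.
Qed.

Lemma territory_near x y : In x LX -> In y LY -> pr y = x -> near x y.
Proof.
  intros Hx Hy Hp. split; [easy|]. pose proof (pr_near y Hy). rewrite Hp in H. lra.
Qed.

(** [prev] and [next] are predicates with at most one point, so the ends of an ordering are no
    special cases. A block with a chart is sorted by it; otherwise its order is arbitrary. *)
Lemma block_exists x (prev next : X -> Prop) : In x LX ->
  (forall q, next q \/ prev q -> In q LX /\ q <> x) ->
  (forall q q', next q -> next q' -> q = q') ->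
  (forall q q', prev q -> prev q' -> q = q') ->
  (forall q q', next q -> prev q' -> q <> q') ->
  exists L R, block x prev next L R.
Proof.
  intros Hx Hin Hn Hp Hnp.
  assert (Hd : NoDup (territory x)) by now apply NoDup_filter.
  assert (Hxt : In x (territory x)) by (apply territory_in; split; [auto|now apply pr_id]).
  destruct (classic (good x)) as [Hg|Hg].
  - destruct (oriented_chart x prev next) as (delta & t & y & Hc & Hy & Hpy & Hgy & H1 & H2);
      try assumption.
    destruct (sort_by_key t (territory x) Hd) as (l & Hl & Hs).
    { intros a b Ha Hb Hab. apply territory_in in Ha. apply territory_in in Hb.
      apply (chart_inj x delta t); auto; now apply territory_near. }
    assert (Hxl : In x l) by now apply (Permutation_in _ Hl).
    destruct (in_split _ _ Hxl) as (L & R & ->).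
    assert (Hm : forall z, In z (L ++ x :: R) <-> In z LY /\ pr z = x).
    { intros z. rewrite <- territory_in. split; apply Permutation_in; [now symmetry|easy]. }
    exists L, R. repeat split.
    + now apply (Permutation_NoDup Hl).
    + now apply Hm.
    + now apply Hm.
    + intros [Hz1 Hz2]. now apply Hm.
    + intros _. exists delta, t. repeat split; try easy; try apply Hc.
      eapply Rle_trans; [exact Hgy|]. apply sumg_in.
      * intros z Hz. apply g_ge0. now apply Hm.
      * now apply Hm.
  - destruct (in_split _ _ Hxt) as (L & R & E). exists L, R.
    assert (Hm : forall z, In z (L ++ x :: R) <-> In z LY /\ pr z = x).
    { intros z. rewrite <- E. apply territory_in. }
    repeat split.
    + now rewrite <- E.
    + now apply Hm.
    + now apply Hm.
    + intros [Hz1 Hz2]. now apply Hm.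
    + easy.
Qed.

(** In the summand [10], [4] pays for a point of a block without chart and [6] for cutting an
    adjacent link at such a block; half-blocks are thus bounded with [step_const - 6]. *)
Definition step_const : R := 1200 * K * Rpower 20 p + 10.

Lemma flat_const_ge0 : 0 <= 1200 * K * Rpower 20 p.
Proof. repeat apply Rmult_le_pos; try lra; apply Rpower_nonneg. Qed.

Lemma flat_error_le delta w :
  Rpower delta p <= w ->
  1200 * K * Rpower 20 p * Rpower delta p * r <= 1200 * K * Rpower 20 p * w * r.
Proof.
  intros H. apply Rmult_le_compat_r; [lra|]. apply Rmult_le_compat_l; [|easy].
  apply flat_const_ge0.
Qed.

Lemma snoc_hd {T : Type} (l : list T) a : l ++ [a] = hd a l :: tl (l ++ [a]).
Proof. now destruct l. Qed.

Section Block.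
Variables (x : X) (prev next : X -> Prop) (L R : list X).
Hypothesis x_in : In x LX.
Hypothesis blk : block x prev next L R.

Lemma block_ge0 : 0 <= sumg g (L ++ x :: R).
Proof. apply sumg_ge0. intros y Hy. apply g_ge0. now apply blk. Qed.

Lemma block_near y : In y (L ++ x :: R) -> In y LY /\ pr y = x /\ vdist y x <= r.
Proof.
  intros Hy. apply blk in Hy. destruct Hy as [Hy Hp]. pose proof (pr_near y Hy) as Hn.
  rewrite Hp in Hn. repeat split; auto. lra.
Qed.

(** Points of a block are within [2 r] of each other, so a link between them costs at most
    [2 r / 2 + 6 (r / 2)], and each point weighs at least [1]. *)
Lemma block_heavy_cost l : ~ good x -> incl l (L ++ x :: R) -> NoDup l ->
  chain (link LY (r / 2)) l <= 4 * r * sumg g (L ++ x :: R).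
Proof.
  intros Hg Hl Hd.
  destruct (good_or_heavy x) as [|Hh]; [easy|].
  eapply Rle_trans; [apply (chain_le_mult _ _ (4 * r))|].
  - intros a b Ha Hb. apply Hl, block_near in Ha. apply Hl, block_near in Hb.
    pose proof (link_le_gap LY (r / 2) a b). pose proof (vdist_tri a x b).
    rewrite (vdist_sym x b) in *. lra.
  - rewrite (Rmult_comm (4 * r)). apply Rmult_le_compat_r; [lra|].
    eapply Rle_trans; [|apply sumg_length].
    + apply le_INR. pose proof (NoDup_incl_length Hd Hl). lia.
    + intros y Hy. apply Hh; now apply blk.
Qed.

Lemma block_right_complete delta t z : flat_chart x delta t ->
  StronglySorted (fun y z => t y < t z) (L ++ x :: R) ->
  near x z -> t x < t z -> pr z = x -> In z R.
Proof.
  intros Hc Hs Nz Hz Hp.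
  assert (Hi : In z (L ++ x :: R)) by (apply blk; split; [apply Nz|easy]).
  apply StronglySorted_app in Hs. destruct Hs as (_ & _ & Hs).
  apply in_app_or in Hi. destruct Hi as [Hi|[->|Hi]]; [|lra|easy].
  specialize (Hs z x Hi ltac:(now left)). lra.
Qed.

Lemma block_left_complete delta t z : flat_chart x delta t ->
  StronglySorted (fun y z => t y < t z) (L ++ x :: R) ->
  near x z -> t z < t x -> pr z = x -> In z L.
Proof.
  intros Hc Hs Nz Hz Hp.
  assert (Hi : In z (L ++ x :: R)) by (apply blk; split; [apply Nz|easy]).
  apply StronglySorted_app in Hs. destruct Hs as (_ & Hs & _).
  apply in_app_or in Hi. destruct Hi as [Hi|[->|Hi]]; [easy|lra|].
  apply StronglySorted_inv in Hs. destruct Hs as [_ Hs]. rewrite Forall_forall in Hs.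
  specialize (Hs z Hi). lra.
Qed.

Lemma block_last : In (last R x) (L ++ x :: R).
Proof. apply in_or_app. right. apply last_in. Qed.

Lemma block_hd : In (hd x L) (L ++ x :: R).
Proof. clear blk. destruct L; now left. Qed.

(** This and [half_left] serve where the path leaves or enters a block by a link that is not flat,
    and at the ends of the ordering. *)
Lemma half_right :
  chain (link LY (r / 2)) (x :: R) <=
    vdist x (last R x) + (step_const - 6) * r * sumg g (L ++ x :: R).
Proof.
  pose proof block_ge0 as H0. pose proof flat_const_ge0 as HC0.
  assert (Hrs : 0 <= r * sumg g (L ++ x :: R)) by (apply Rmult_le_pos; lra).
  pose proof (Rmult_le_pos _ _ HC0 Hrs).
  destruct (classic (good x)) as [Hg|Hg].
  - destruct blk as (Hd & Hm & Hgood).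
    destruct (Hgood Hg) as (delta & t & Hc & Hw & Hs & _ & _).
    assert (Hsub : forall z, In z (x :: R) -> In z (L ++ x :: R)).
    { intros z Hz. apply in_or_app. now right. }
    assert (Nl : near x (last R x)).
    { destruct (block_near _ block_last) as (? & ? & ?). split; [easy|lra]. }
    pose proof (chart_iso x delta t x (last R x) Hc (near_self x x_in) Nl) as [[I1 I2] _].
    destruct (block_near _ block_last) as (_ & Hpl & Hrl).
    eapply Rle_trans; [apply (flat_segment_cost K p x delta t); try assumption|].
    + intros z Hz. destruct (block_near z (Hsub z Hz)) as (? & _ & ?). split; [easy|lra].
    + now apply StronglySorted_app in Hs.
    + intros z Nz [Hz1 Hz2]. right.
      assert (Hpz : near x (pr z)).
      { apply near_LX; [apply pr_in, Nz|]. pose proof (pr_near z (proj1 Nz)).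
        pose proof (vdist_tri (pr z) z x). rewrite (vdist_sym (pr z) z) in *.
        assert (vdist z x <= 2 * r).
        { pose proof (chart_iso x delta t x z Hc (near_self x x_in) Nz) as [_ [I|I]];
            rewrite vdist_sym; rewrite (vdist_sym x (last R x)) in *; lra. }
        lra. }
      apply (block_right_complete delta t); try easy.
      (* Both [x] and [last R x] belong to the cell of [x]; a different cell would put [z] before
         the one or after the other. *)
      apply NNPP. intros Hn.
      assert (Hne : t (pr z) <> t x) by (apply (chart_inj x delta t); auto; now apply near_self).
      assert (Hpx : pr x = x) by now apply pr_id.
      destruct (Rtotal_order (t (pr z)) (t x)) as [Hlt|[|Hlt]]; [|easy|].
      * pose proof (territory_order x delta t z x Hc Nz (near_self x x_in) Hpz) as T.
        rewrite Hpx in T. specialize (T (near_self x x_in) Hlt). lra.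
      * pose proof (territory_order x delta t (last R x) z Hc Nl Nz) as T.
        rewrite Hpl in T. specialize (T (near_self x x_in) Hpz Hlt). lra.
    + rewrite (vdist_sym x (last R x)) in *. lra.
    + pose proof (flat_error_le delta _ Hw). unfold step_const. lra.
  - eapply Rle_trans; [apply block_heavy_cost; try assumption|].
    + intros z Hz. apply in_or_app. now right.
    + destruct blk as (Hd & _). now apply NoDup_app_remove_l in Hd.
    + pose proof (vdist_pos x (last R x)). unfold step_const. lra.
Qed.

Lemma half_left :
  chain (link LY (r / 2)) (L ++ [x]) <=
    vdist (hd x L) x + (step_const - 6) * r * sumg g (L ++ x :: R).
Proof.
  pose proof block_ge0 as H0. pose proof flat_const_ge0 as HC0.
  assert (Hrs : 0 <= r * sumg g (L ++ x :: R)) by (apply Rmult_le_pos; lra).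
  pose proof (Rmult_le_pos _ _ HC0 Hrs).
  assert (Hsub : forall z, In z (L ++ [x]) -> In z (L ++ x :: R)).
  { intros z Hz. apply in_or_app. apply in_app_or in Hz.
    destruct Hz as [Hz|[->|[]]]; [now left|right; now left]. }
  destruct (classic (good x)) as [Hg|Hg].
  - destruct blk as (Hd & Hm & Hgood).
    destruct (Hgood Hg) as (delta & t & Hc & Hw & Hs & _ & _).
    assert (Nl : near x (hd x L)).
    { destruct (block_near _ block_hd) as (? & ? & ?). split; [easy|lra]. }
    pose proof (chart_iso x delta t (hd x L) x Hc Nl (near_self x x_in)) as [[I1 I2] _].
    destruct (block_near _ block_hd) as (_ & Hpl & Hrl).
    assert (Hlast : last (tl (L ++ [x])) (hd x L) = x).
    { rewrite <- (last_cons (hd x L) (hd x L)), <- snoc_hd. apply last_snoc. }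
    rewrite snoc_hd.
    eapply Rle_trans; [apply (flat_segment_cost K p x delta t); try assumption|].
    + rewrite <- snoc_hd.
      intros z Hz. destruct (block_near z (Hsub z Hz)) as (? & _ & ?). split; [easy|lra].
    + rewrite <- snoc_hd. replace (L ++ x :: R) with ((L ++ [x]) ++ R) in Hs
        by now rewrite <- app_assoc.
      now apply StronglySorted_app in Hs.
    + rewrite Hlast, <- snoc_hd. intros z Nz [Hz1 Hz2]. apply in_or_app. left.
      assert (Hpz : near x (pr z)).
      { apply near_LX; [apply pr_in, Nz|]. pose proof (pr_near z (proj1 Nz)).
        pose proof (vdist_tri (pr z) z x). rewrite (vdist_sym (pr z) z) in *.
        assert (vdist z x <= 2 * r).
        { pose proof (chart_iso x delta t z x Hc Nz (near_self x x_in)) as [_ [I|I]]; lra. }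
        lra. }
      apply (block_left_complete delta t); try easy.
      apply NNPP. intros Hn.
      assert (Hne : t (pr z) <> t x) by (apply (chart_inj x delta t); auto; now apply near_self).
      assert (Hpx : pr x = x) by now apply pr_id.
      destruct (Rtotal_order (t (pr z)) (t x)) as [Hlt|[|Hlt]]; [|easy|].
      * pose proof (territory_order x delta t z (hd x L) Hc Nz Nl Hpz) as T.
        rewrite Hpl in T. specialize (T (near_self x x_in) Hlt). lra.
      * pose proof (territory_order x delta t x z Hc (near_self x x_in) Nz) as T.
        rewrite Hpx in T. specialize (T (near_self x x_in) Hpz Hlt). lra.
    + rewrite Hlast. lra.
    + rewrite Hlast. pose proof (flat_error_le delta _ Hw). unfold step_const. lra.
  - eapply Rle_trans; [apply block_heavy_cost; try assumption|].
    + destruct blk as (Hd & _). replace (L ++ x :: R) with ((L ++ [x]) ++ R) in Hd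
        by now rewrite <- app_assoc.
      now apply NoDup_app_remove_r in Hd.
    + pose proof (vdist_pos (hd x L) x). unfold step_const. lra.
Qed.

End Block.

(** * The refined path between two consecutive points of the coarse ordering *)

Section Segment.
Variables (x x' : X) (prev next prev' next' : X -> Prop) (L R L' R' : list X).
Hypothesis x_in : In x LX.
Hypothesis x_in' : In x' LX.
Hypothesis x_neq : x <> x'.
Hypothesis blk : block x prev next L R.
Hypothesis blk' : block x' prev' next' L' R'.
Hypothesis x_next : next x'.
Hypothesis x_prev : prev' x.

(** Everything is measured in the chart of [x], and only the block of [x] is charged. [L'] is sorted
    by the chart of [x']; both charts put [x] before [x'], so they order [L'] alike. The empty lune
    guarantees that the path misses no point of [LY] between [x] and [x']. *)
Lemma segment_cost_flat : adjacent LX r x x' -> good x -> good x' ->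
  chain (link LY (r / 2)) (x :: R ++ L' ++ [x']) <=
    vdist x x' + step_const * r * sumg g (L ++ x :: R).
Proof.
  intros Ha Hg Hg'.
  pose proof (block_ge0 _ _ _ _ _ blk) as H0. pose proof flat_const_ge0 as HC0.
  pose proof (proj1 Ha) as Hxx.
  assert (Nx : near x x) by now apply near_self.
  assert (Nx' : near x x') by (apply near_LX; [easy|rewrite vdist_sym; lra]).
  assert (Nx1 : near x' x) by (apply near_LX; [easy|lra]).
  assert (Nx1' : near x' x') by now apply near_self.
  destruct (proj2 (proj2 blk) Hg) as (delta & t & Hc & Hw & Hs & Hnext & _).
  destruct (proj2 (proj2 blk') Hg') as (delta' & t' & Hc' & _ & Hs' & _ & Hprev').
  specialize (Hnext x' x_next Ha). specialize (Hprev' x x_prev Ha).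
  assert (HR : forall z, In z R -> near x z /\ pr z = x /\ vdist z x <= r /\ t x < t z).
  { intros z Hz. assert (Hz' : In z (L ++ x :: R)) by (apply in_or_app; right; now right).
    destruct (block_near _ _ _ _ _ blk z Hz') as (Hz1 & Hz2 & Hz3).
    repeat split; try easy; [lra|].
    apply StronglySorted_app in Hs. destruct Hs as (_ & Hs & _).
    apply StronglySorted_inv in Hs. destruct Hs as [_ Hs]. rewrite Forall_forall in Hs. auto. }
  assert (HL : forall z, In z L' -> near x z /\ near x' z /\ pr z = x' /\ vdist z x' <= r /\
     vdist z x <= 13 * r /\ z <> x /\ z <> x' /\ t' z < t' x' /\ t z < t x').
  { intros z Hz. assert (Hz' : In z (L' ++ x' :: R')) by (apply in_or_app; now left).
    destruct (block_near _ _ _ _ _ blk' z Hz') as (Hz1 & Hz2 & Hz3).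
    pose proof (vdist_tri z x' x). rewrite (vdist_sym x' x) in *.
    assert (N1 : near x z) by (split; [easy|lra]).
    assert (N2 : near x' z) by (split; [easy|lra]).
    assert (z <> x) by (intros ->; now rewrite (pr_id x x_in) in Hz2).
    assert (Hlt : t' z < t' x').
    { apply StronglySorted_app in Hs'. destruct Hs' as (_ & _ & Hs').
      apply Hs'; [easy|now left]. }
    assert (z <> x') by (intros ->; lra).
    repeat split; try easy; try apply N1; try lra.
    apply (order_agree_left x' delta' t' x delta t x x' z); auto. }
  assert (HLs : StronglySorted (fun y z => t y < t z) L').
  { apply StronglySorted_app in Hs'. destruct Hs' as (Hs' & _).
    eapply StronglySorted_weaken; [|exact Hs']. intros y z Hy Hz Hyz.
    destruct (HL y Hy) as (? & ? & ? & ? & ? & ? & ? & ? & ?).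
    destruct (HL z Hz) as (? & ? & ? & ? & ? & ? & ? & ? & ?).
    apply (order_agree_right x' delta' t' x delta t y x' z); auto. intros ->; lra. }
  pose proof (chart_iso x delta t x x' Hc Nx Nx') as [[I1 I2] _].
  assert (Hlast : last (R ++ L' ++ [x']) x = x') by now rewrite app_assoc, last_snoc.
  eapply Rle_trans; [apply (flat_segment_cost K p x delta t); try assumption|].
  - intros z [<-|Hz]; [split; [auto|rewrite vdist_refl; lra]|].
    apply in_app_or in Hz. destruct Hz as [Hz|Hz].
    + destruct (HR z Hz) as (N & _ & ? & _). split; [apply N|lra].
    + apply in_app_or in Hz. destruct Hz as [Hz|[<-|[]]].
      * destruct (HL z Hz) as (N & _ & _ & _ & ? & _). split; [apply N|lra].
      * split; [auto|]. rewrite vdist_sym. lra.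
  - change (x :: R ++ L' ++ [x']) with ((x :: R) ++ L' ++ [x']).
    apply StronglySorted_app. split; [now apply StronglySorted_app in Hs|]. split.
    + apply StronglySorted_app. split; [easy|]. split; [repeat constructor|].
      intros a b Ha' [<-|[]]. now apply HL.
    + intros a b Ha' Hb.
      assert (Na : near x a /\ pr a = x).
      { destruct Ha' as [<-|Ha']; [now split; [|apply pr_id]|]. now split; apply HR. }
      assert (Nb : near x b /\ pr b = x').
      { apply in_app_or in Hb. destruct Hb as [Hb|[<-|[]]].
        - now split; apply HL.
        - now split; [|apply pr_id]. }
      destruct Na as [Na Pa]. destruct Nb as [Nb Pb].
      apply (territory_order x delta t); try easy; now rewrite ?Pa, ?Pb.
  - rewrite Hlast. intros z Nz [Hz1 Hz2]. right.
    assert (Hzx : vdist z x <= 13 * r).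
    { pose proof (chart_iso x delta t z x Hc Nz Nx) as [_ [I|I]]; lra. }
    assert (Hzx' : vdist z x' <= 25 * r).
    { pose proof (vdist_tri z x x'). lra. }
    assert (Hpz : near x (pr z)).
    { apply near_LX; [apply pr_in, Nz|]. pose proof (pr_near z (proj1 Nz)).
      pose proof (vdist_tri (pr z) z x). rewrite (vdist_sym (pr z) z) in *. lra. }
    assert (Px : pr x = x) by now apply pr_id.
    assert (Px' : pr x' = x') by now apply pr_id.
    destruct (classic (pr z = x)) as [E|E].
    { apply in_or_app. left. now apply (block_right_complete _ _ _ _ _ x_in blk delta t). }
    destruct (classic (pr z = x')) as [E'|E'].
    { apply in_or_app. right. apply in_or_app. left.
      assert (Nz' : near x' z) by (split; [apply Nz|lra]).
      apply (block_left_complete _ _ _ _ _ x_in' blk' delta' t'); try easy.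
      apply (order_agree_left x delta t x' delta' t' x x' z); auto; intros ->; lra. }
    (* The centre of a third cell lies before [x] or after [x'], and then so does [z], or it lies
       between them, hence in the lune. *)
    exfalso.
    assert (t (pr z) <> t x) by (apply (chart_inj x delta t); auto).
    assert (t (pr z) <> t x') by (apply (chart_inj x delta t); auto).
    destruct (Rlt_le_dec (t (pr z)) (t x)) as [Hlt|Hle].
    { pose proof (territory_order x delta t z x Hc Nz Nx Hpz) as T.
      rewrite Px in T. specialize (T Nx Hlt). lra. }
    destruct (Rlt_le_dec (t x') (t (pr z))) as [Hlt|Hle'].
    { pose proof (territory_order x delta t x' z Hc Nx' Nz) as T.
      rewrite Px' in T. specialize (T Nx' Hpz Hlt). lra. }
    apply (proj2 Ha (pr z)); [apply pr_in, Nz|].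
    apply (between_lune x delta t x x' (pr z)); auto. lra.
  - rewrite Hlast. lra.
  - rewrite Hlast. pose proof (flat_error_le delta _ Hw).
    assert (0 <= r * sumg g (L ++ x :: R)) by (apply Rmult_le_pos; lra).
    unfold step_const. lra.
Qed.

Lemma segment_cost :
  chain (link LY (r / 2)) (x :: R ++ L' ++ [x']) <=
    link LX r x x' + step_const * r * (sumg g (L ++ x :: R) + sumg g (L' ++ x' :: R')).
Proof.
  pose proof (block_ge0 _ _ _ _ _ blk) as H0. pose proof (block_ge0 _ _ _ _ _ blk') as H0'.
  pose proof flat_const_ge0 as HC0.
  set (w := sumg g (L ++ x :: R)) in *. set (w' := sumg g (L' ++ x' :: R')) in *.
  assert (Hrw : 0 <= r * w) by (apply Rmult_le_pos; lra).
  assert (Hrw' : 0 <= r * w') by (apply Rmult_le_pos; lra).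
  assert (Hsw : 0 <= 1200 * K * Rpower 20 p * (r * w)) by now apply Rmult_le_pos.
  assert (Hsw' : 0 <= 1200 * K * Rpower 20 p * (r * w')) by now apply Rmult_le_pos.
  destruct (classic (adjacent LX r x x' /\ good x /\ good x')) as [(Ha & Hg & Hg')|Hn].
  { rewrite (link_adjacent _ _ _ _ Ha). eapply Rle_trans; [now apply segment_cost_flat|].
    fold w. unfold step_const. lra. }
  (* The path is cut at the link from the last point of one block to the first point of the next,
     which is priced as a gap. *)
  rewrite (snoc_hd L' x'), chain_app, <- snoc_hd.
  pose proof (half_right _ _ _ _ _ x_in blk) as HR. fold w in HR.
  pose proof (half_left _ _ _ _ _ x_in' blk') as HL. fold w' in HL.
  destruct (block_near _ _ _ _ _ blk _ (block_last x L R)) as (_ & _ & Hl).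
  destruct (block_near _ _ _ _ _ blk' _ (block_hd x' L' R')) as (_ & _ & Hh).
  pose proof (link_le_gap LY (r / 2) (last R x) (hd x' L')) as Hlk.
  pose proof (vdist_tri (last R x) x (hd x' L')) as T1.
  pose proof (vdist_tri x x' (hd x' L')) as T2.
  rewrite (vdist_sym x (last R x)) in *. rewrite (vdist_sym x' (hd x' L')) in *.
  destruct (classic (adjacent LX r x x')) as [Ha|Ha].
  (* An adjacent link holds no reserve, but here one of the two blocks has no chart, weighs at least
     [1], and pays the [6 r]. *)
  - assert (Hw : r <= r * w + r * w').
    { assert (Hheavy : 1 <= w \/ 1 <= w').
      { destruct (classic (good x)) as [Hg|Hg].
        - right. destruct (good_or_heavy x') as [|Hb]; [tauto|].
          eapply Rle_trans; [apply (Hb x'); [auto|now apply pr_id]|].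
          apply sumg_in; [intros y Hy; apply g_ge0; now apply blk'|].
          apply in_or_app. right. now left.
        - left. destruct (good_or_heavy x) as [|Hb]; [tauto|].
          eapply Rle_trans; [apply (Hb x); [auto|now apply pr_id]|].
          apply sumg_in; [intros y Hy; apply g_ge0; now apply blk|].
          apply in_or_app. right. now left. }
      destruct Hheavy as [Hh1|Hh1]; apply (Rmult_le_compat_l r) in Hh1; lra. }
    pose proof (link_ge_half LX r x x' (Rlt_le _ _ r_pos)).
    pose proof (link_adjacent _ _ _ _ Ha). unfold step_const in *. lra.
  (* Overshoots of [3 r] and the new reserve [3 r] use up the old reserve. *)
  - pose proof (link_not_adjacent _ _ _ _ Ha) as E. rewrite E. lra.
Qed.

End Segment.

(** * Concatenating the blocks *)

Section Refine.
Variables (L R : X -> list X).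
Hypothesis blocks : forall x, In x LX ->
  block x (fun q => follows LX q x) (follows LX x) (L x) (R x).

Let refined (l : list X) : list X := flat_map (fun x => L x ++ x :: R x) l.

Lemma refined_in y : In y (refined LX) <-> In y LY.
Proof.
  unfold refined. rewrite in_flat_map. split.
  - intros (x & Hx & Hy). now apply (blocks x Hx).
  - intros Hy. exists (pr y). split; [now apply pr_in|].
    apply (blocks (pr y)); auto.
Qed.

Lemma refined_nodup l : NoDup l -> incl l LX -> NoDup (refined l).
Proof.
  induction l as [|x l IH]; intros Hd Hi; [constructor|].
  apply NoDup_cons_iff in Hd. destruct Hd as [Hx Hd].
  simpl. apply NoDup_app.
  - apply (blocks x). apply Hi. now left.
  - apply IH; [easy|]. intros z Hz. apply Hi. now right.
  - intros y Hy Hy'. apply in_flat_map in Hy'. destruct Hy' as (x' & Hx' & Hy').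
    apply (blocks x) in Hy; [|apply Hi; now left].
    apply (blocks x') in Hy'; [|apply Hi; now right].
    destruct Hy as [_ <-]. destruct Hy' as [_ E]. now rewrite E in Hx.
Qed.

Lemma refined_perm : Permutation LY (refined LX).
Proof.
  apply NoDup_Permutation; [easy|now apply refined_nodup|].
  intros y. now rewrite refined_in.
Qed.

Lemma refined_subseq l : subseq l (refined l).
Proof.
  induction l as [|x l IH]; simpl; [constructor|].
  rewrite <- app_assoc. simpl.
  apply (subseq_app [] (L x) (x :: l)); [apply subseq_empty|].
  apply subseq_keep, (subseq_app [] (R x) l); [apply subseq_empty|easy].
Qed.

Lemma step_const_ge : 10 <= step_const.
Proof. unfold step_const. pose proof flat_const_ge0. lra. Qed.

(** A block is charged by the link before it and by the link, or the end of the path, after it: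
    hence the factor [2]. The part of the first block before [x] is left to [refined_cost]. The
    summand [r] is the overshoot beyond the last point. *)
Lemma refined_tail_cost x l pre : LX = pre ++ x :: l ->
  chain (link LY (r / 2)) (x :: R x ++ refined l) <=
    chain (link LX r) (x :: l) + r +
    step_const * r * (sumg g (L x ++ x :: R x) + 2 * sumg g (refined l)).
Proof.
  pose proof step_const_ge as HS.
  revert x pre. induction l as [|x' l IH]; intros x pre E.
  - assert (Hx : In x LX) by (rewrite E; apply in_or_app; right; now left).
    simpl refined. rewrite app_nil_r. change (sumg g []) with 0.
    pose proof (half_right _ _ _ _ _ Hx (blocks x Hx)) as H.
    pose proof (block_ge0 _ _ _ _ _ (blocks x Hx)) as H0.
    destruct (block_near _ _ _ _ _ (blocks x Hx) _ (block_last x (L x) (R x))) as (_ & _ & Hl).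
    rewrite (vdist_sym x) in H.
    assert (0 <= r * sumg g (L x ++ x :: R x)) by (apply Rmult_le_pos; lra).
    simpl (chain (link LX r) [x]). lra.
  - assert (Hf : follows LX x x') by now exists pre, l.
    destruct (follows_in _ _ _ Hf) as [Hx Hx'].
    pose proof (follows_neq _ _ _ LX_nodup Hf) as Hn.
    specialize (IH x' (pre ++ [x])). rewrite <- app_assoc in IH. specialize (IH E).
    simpl refined.
    replace (x :: R x ++ (L x' ++ x' :: R x') ++ refined l)
      with ((x :: R x ++ L x') ++ x' :: (R x' ++ refined l)).
    2:{ simpl. now rewrite <- !app_assoc. }
    rewrite chain_split, chain_cons2.
    replace ((x :: R x ++ L x') ++ [x']) with (x :: R x ++ L x' ++ [x'])
      by (simpl; now rewrite <- app_assoc).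
    pose proof (segment_cost x x' _ _ _ _ _ _ _ _ Hx Hx' Hn (blocks x Hx)
      (blocks x' Hx') Hf Hf) as HC.
    rewrite (sumg_app g (L x' ++ x' :: R x')).
    eapply Rle_trans; [apply Rplus_le_compat; [exact HC|exact IH]|]. apply Req_le. ring.
Qed.

(** The reserve for the two ends of the path drops by [3 r], while the path grows beyond its first
    and last points by at most [r] each. *)
Lemma refined_cost :
  chain (link LY (r / 2)) (refined LX) + 6 * (r / 2) <=
    chain (link LX r) LX + 6 * r + 2 * step_const * r * sumg g LY.
Proof.
  pose proof step_const_ge as HS. pose proof refined_perm as HP.
  assert (H0 : 0 <= r * sumg g LY).
  { apply Rmult_le_pos; [lra|]. now apply sumg_ge0. }
  assert (HS0 : 0 <= (step_const - 10) * (r * sumg g LY)) by (apply Rmult_le_pos; lra).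
  rewrite (sumg_perm g _ _ HP) in *.
  destruct LX as [|x l] eqn:E.
  - simpl in *. lra.
  - assert (Hx : In x LX) by (rewrite E; now left).
    rewrite <- E in *.
    pose proof (refined_tail_cost x l [] E) as HT.
    pose proof (half_left _ _ _ _ _ Hx (blocks x Hx)) as H.
    pose proof (block_ge0 _ _ _ _ _ (blocks x Hx)) as H1.
    destruct (block_near _ _ _ _ _ (blocks x Hx) _ (block_hd x (L x) (R x))) as (_ & _ & Hh).
    assert (E' : refined LX = L x ++ x :: (R x ++ refined l)).
    { rewrite E. simpl. now rewrite <- app_assoc. }
    assert (Es : sumg g (refined LX) = sumg g (L x ++ x :: R x) + sumg g (refined l)).
    { rewrite E. simpl. apply sumg_app. }
    rewrite Es in *.
    rewrite E', chain_split. rewrite <- E in HT.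
    assert (0 <= r * sumg g (L x ++ x :: R x)) by (apply Rmult_le_pos; lra).
    lra.
Qed.

End Refine.

Lemma refine_ordering : exists l, Permutation LY l /\ subseq LX l /\
  chain (link LY (r / 2)) l + 6 * (r / 2) <=
    chain (link LX r) LX + 6 * r + 2 * step_const * r * sumg g LY.
Proof.
  assert (H : forall x, exists LR : list X * list X, In x LX ->
    block x (fun q => follows LX q x) (follows LX x) (fst LR) (snd LR)).
  { intros x. destruct (classic (In x LX)) as [Hx|Hx]; [|now exists ([], [])].
    destruct (block_exists x (fun q => follows LX q x) (follows LX x) Hx) as (L & R & HLR).
    - intros q [Hq|Hq]; pose proof (follows_in _ _ _ Hq);
        pose proof (follows_neq _ _ _ LX_nodup Hq); intuition.
    - intros q q'. now apply follows_next_unique.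
    - intros q q'. now apply follows_prev_unique.
    - intros q q' Hq Hq' <-. now apply (follows_asym LX x q).
    - now exists (L, R). }
  set (c := fun x => proj1_sig (constructive_indefinite_description _ (H x))).
  assert (Hc : forall x, In x LX ->
    block x (fun q => follows LX q x) (follows LX x) (fst (c x)) (snd (c x))).
  { intros x. exact (proj2_sig (constructive_indefinite_description _ (H x))). }
  exists (flat_map (fun x => fst (c x) ++ x :: snd (c x)) LX). split; [|split].
  - now apply (refined_perm (fun x => fst (c x)) (fun x => snd (c x))).
  - apply (refined_subseq (fun x => fst (c x)) (fun x => snd (c x))).
  - now apply (refined_cost (fun x => fst (c x)) (fun x => snd (c x))).
Qed.

End Charts.

(** * Lipschitz curves through relations on the line *)

Section LipschitzCurve.
Context {X : Banach}.

Lemma is_lub_approx (S : R -> Prop) s eps : is_lub S s -> 0 < eps -> exists u, S u /\ s - eps < u.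
Proof.
  intros [_ Hs] He. apply NNPP. intros Hn.
  enough (s <= s - eps) by lra. apply Hs. intros u Hu.
  apply Rnot_lt_le. intros Hlt. apply Hn. now exists u.
Qed.

Lemma inv_small eps : 0 < eps -> exists N, forall n, (N <= n)%nat -> / (INR n + 1) < eps.
Proof.
  intros He. destruct (archimed (/ eps)) as [Ha _].
  assert (Hi : 0 < / eps) by now apply Rinv_0_lt_compat.
  exists (Z.to_nat (up (/ eps))). intros n Hn.
  rewrite <- (Rinv_inv eps). apply Rinv_lt_contravar.
  - apply Rmult_lt_0_compat; [easy|]. pose proof (pos_INR n). lra.
  - assert (IZR (up (/ eps)) <= INR n).
    { rewrite INR_IZR_INZ. apply IZR_le. lia. }
    lra.
Qed.

Section Extension.
Variables (S : R -> X -> Prop) (len : R).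
Hypothesis S_ne : exists s x, S s x.
Hypothesis S_bound : forall s x, S s x -> 0 <= s <= len.
Hypothesis S_lip : forall s x s' x', S s x -> S s' x' -> vdist x x' <= Rabs (s - s').

Let dom (u : R) : Prop := forall eps, 0 < eps -> exists s x, S s x /\ Rabs (u - s) < eps.
(** The closure of [S] in the product. Completeness of the space provides a value at every point of
    [dom], and the Lipschitz bound makes it unique. *)
Let G (u : R) (z : X) : Prop := forall eps, 0 < eps ->
  exists s x, S s x /\ Rabs (u - s) < eps /\ vdist z x < eps.

Lemma G_dom u z : G u z -> dom u.
Proof.
  intros H eps He. destruct (H eps He) as (s & x & Hs & Hu & _). now exists s, x.
Qed.

Lemma G_lip u z u' z' : G u z -> G u' z' -> vdist z z' <= Rabs (u - u').
Proof.
  intros H H'. apply Rnot_lt_le. intros Hlt.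
  set (eps := (vdist z z' - Rabs (u - u')) / 4).
  assert (He : 0 < eps) by (unfold eps; lra).
  destruct (H eps He) as (s & x & Hs & Hu & Hz).
  destruct (H' eps He) as (s' & x' & Hs' & Hu' & Hz').
  pose proof (S_lip _ _ _ _ Hs Hs') as HL.
  pose proof (vdist_tri z x z') as T1. pose proof (vdist_tri x x' z') as T2.
  rewrite (vdist_sym x' z') in T2.
  assert (Rabs (s - s') <= Rabs (u - u') + Rabs (u - s) + Rabs (u' - s')).
  { unfold Rabs. repeat destruct Rcase_abs; lra. }
  unfold eps in *. lra.
Qed.

Lemma dom_G u : dom u -> exists z, G u z.
Proof.
  intros Hu.
  assert (Hp : forall n : nat, 0 < / (INR n + 1)).
  { intros n. apply Rinv_0_lt_compat. pose proof (pos_INR n). lra. }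
  assert (Hn : forall n : nat, exists sx : R * X,
    S (fst sx) (snd sx) /\ Rabs (u - fst sx) < / (INR n + 1)).
  { intros n. destruct (Hu _ (Hp n)) as (s & x & Hs & Hx). now exists (s, x). }
  set (c := fun n => proj1_sig (constructive_indefinite_description _ (Hn n))).
  assert (Hc : forall n, S (fst (c n)) (snd (c n)) /\ Rabs (u - fst (c n)) < / (INR n + 1)).
  { intros n. exact (proj2_sig (constructive_indefinite_description _ (Hn n))). }
  destruct (vcomplete X (fun n => snd (c n))) as [z Hz].
  - intros eps He. destruct (inv_small (eps / 2)) as [N HN]; [lra|].
    exists N. intros m n Hm Hn'.
    destruct (Hc m) as [Hm1 Hm2]. destruct (Hc n) as [Hn1 Hn2].
    pose proof (S_lip _ _ _ _ Hm1 Hn1) as HL. unfold vdist in HL.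
    specialize (HN m Hm) as HNm. specialize (HN n Hn').
    assert (Rabs (fst (c m) - fst (c n)) <= Rabs (u - fst (c m)) + Rabs (u - fst (c n))).
    { unfold Rabs. repeat destruct Rcase_abs; lra. }
    lra.
  - exists z. intros eps He. destruct (inv_small eps He) as [N HN].
    destruct (Hz eps He) as [N' HN']. set (n := Nat.max N N').
    exists (fst (c n)), (snd (c n)). destruct (Hc n) as [H1 H2].
    specialize (HN n ltac:(unfold n; lia)). specialize (HN' n ltac:(unfold n; lia)).
    repeat split; [easy|lra|]. rewrite vdist_sym. exact HN'.
Qed.

Lemma dom_closed u : (forall eps, 0 < eps -> exists d, dom d /\ Rabs (u - d) < eps) -> dom u.
Proof.
  intros H eps He. destruct (H (eps / 2)) as (d & Hd & Hu); [lra|].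
  destruct (Hd (eps / 2)) as (s & x & Hs & Hds); [lra|].
  exists s, x. split; [easy|]. unfold Rabs in *. repeat destruct Rcase_abs; lra.
Qed.

Lemma dom_bound u : dom u -> 0 <= u <= len.
Proof.
  intros Hu. split; apply Rnot_lt_le; intros Hlt.
  - destruct (Hu (- u)) as (s & x & Hs & Hsu); [lra|]. apply S_bound in Hs.
    unfold Rabs in Hsu. destruct Rcase_abs; lra.
  - destruct (Hu (u - len)) as (s & x & Hs & Hsu); [lra|]. apply S_bound in Hs.
    unfold Rabs in Hsu. destruct Rcase_abs; lra.
Qed.

Lemma dom_sup (P : R -> Prop) b : (exists d, dom d /\ P d) -> (forall d, dom d -> P d -> d <= b) ->
  exists m, dom m /\ m <= b /\ forall d, dom d -> P d -> d <= m.
Proof.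
  intros (d0 & Hd0 & HP0) Hb.
  destruct (completeness (fun d => dom d /\ P d)) as [m Hm].
  - exists b. intros d [H1 H2]. auto.
  - now exists d0.
  - exists m. split; [|split].
    + apply dom_closed. intros eps He.
      destruct (is_lub_approx _ _ eps Hm He) as (d & Hd & Hlt).
      exists d. split; [apply Hd|]. apply Hm in Hd.
      unfold Rabs. destruct Rcase_abs; lra.
    + apply Hm. intros d [H1 H2]. auto.
    + intros d H1 H2. now apply Hm.
Qed.

Lemma dom_inf (P : R -> Prop) b : (exists d, dom d /\ P d) -> (forall d, dom d -> P d -> b <= d) ->
  exists m, dom m /\ b <= m /\ forall d, dom d -> P d -> m <= d.
Proof.
  intros (d0 & Hd0 & HP0) Hb.
  destruct (completeness (fun e => dom (- e) /\ P (- e))) as [m Hm].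
  - exists (- b). intros d [H1 H2]. specialize (Hb _ H1 H2). lra.
  - exists (- d0). now rewrite Ropp_involutive.
  - exists (- m). split; [|split].
    + apply dom_closed. intros eps He.
      destruct (is_lub_approx _ _ eps Hm He) as (d & Hd & Hlt).
      exists (- d). split; [apply Hd|]. apply Hm in Hd.
      unfold Rabs. destruct Rcase_abs; lra.
    + enough (m <= - b) by lra. apply Hm. intros d [H1 H2]. specialize (Hb _ H1 H2). lra.
    + intros d H1 H2. enough (- d <= m) by lra. apply Hm. now rewrite Ropp_involutive.
Qed.

(** Affine interpolation across the gaps of the closed set [dom]. The case [l = r = u] is allowed:
    the quotient is then a product with factor [0], whatever [/ 0] is. *)
Let interp (u : R) (z : X) : Prop := exists l r zl zr,
  G l zl /\ G r zr /\ l <= u <= r /\ (forall d, dom d -> d <= l \/ r <= d) /\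
  z = zl +v ((u - l) / (r - l)) *v (zr -v zl).

Lemma interp_ends (l r u : R) (zl zr z : X) : G l zl -> G r zr -> l <= u <= r ->
  z = zl +v ((u - l) / (r - l)) *v (zr -v zl) -> vdist z zl <= u - l /\ vdist z zr <= r - u.
Proof.
  intros Hl Hr Hu ->.
  pose proof (G_lip _ _ _ _ Hl Hr) as HL. rewrite Rabs_left1 in HL by lra.
  rewrite vdist_sym in HL. unfold vdist in HL. set (q := (u - l) / (r - l)).
  assert (Hq : 0 <= q <= 1 /\ q * (r - l) = u - l).
  { destruct (Req_dec l r) as [->|Hne].
    - unfold q. replace (u - r) with 0 by lra. unfold Rdiv. lra.
    - assert (Hp : 0 < / (r - l)) by (apply Rinv_0_lt_compat; lra).
      assert (E : q * (r - l) = u - l) by (unfold q; field; lra).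
      split; [|easy]. split; [apply Rmult_le_pos; lra|].
      apply (Rmult_le_reg_r (r - l)); lra. }
  destruct Hq as [Hq Eq]. unfold vdist. split.
  - replace (zl +v q *v (zr -v zl) -v zl) with (q *v (zr -v zl)) by vec.
    rewrite vnorm_scal_pos by lra. rewrite <- Eq. apply Rmult_le_compat_l; lra.
  - replace (zl +v q *v (zr -v zl) -v zr) with (vopp ((1 - q) *v (zr -v zl))) by vec.
    rewrite vnorm_opp, vnorm_scal_pos by lra.
    replace (r - u) with ((1 - q) * (r - l)) by lra. apply Rmult_le_compat_l; lra.
Qed.

(** Two gaps are either separated, and the estimate passes through their end points, or equal, and
    there the interpolation is affine with slope at most [1]. *)
Lemma interp_lip u w z z' : interp u z -> interp w z' -> u <= w -> vdist z z' <= w - u.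
Proof.
  intros (l & r & zl & zr & Hl & Hr & Hu & Hd & Hz)
    (l' & r' & zl' & zr' & Hl' & Hr' & Hw & Hd' & Hz') Huw.
  destruct (interp_ends l r u zl zr z Hl Hr Hu Hz) as [A1 A2].
  destruct (interp_ends l' r' w zl' zr' z' Hl' Hr' Hw Hz') as [B1 B2].
  destruct (Rle_lt_dec r l') as [H1|H1].
  - pose proof (G_lip _ _ _ _ Hr Hl') as HL. rewrite Rabs_left1 in HL by lra.
    pose proof (vdist_tri z zr z'). pose proof (vdist_tri zr zl' z').
    rewrite (vdist_sym zl' z') in *. lra.
  - destruct (Rle_lt_dec r' l) as [H2|H2].
    + pose proof (G_lip _ _ _ _ Hl Hr') as HL. rewrite Rabs_right in HL by lra.
      pose proof (vdist_tri z zl z'). pose proof (vdist_tri zl zr' z').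
      rewrite (vdist_sym zr' z') in *. lra.
    + assert (El : l = l').
      { destruct (Hd l' (G_dom _ _ Hl')); destruct (Hd' l (G_dom _ _ Hl)); lra. }
      assert (Er : r = r').
      { destruct (Hd r' (G_dom _ _ Hr')); destruct (Hd' r (G_dom _ _ Hr)); lra. }
      subst l' r'.
      assert (zl = zl').
      { apply vdist_eq0. pose proof (G_lip _ _ _ _ Hl Hl') as HL.
        now rewrite Rminus_diag, Rabs_R0 in HL. }
      assert (zr = zr').
      { apply vdist_eq0. pose proof (G_lip _ _ _ _ Hr Hr') as HL.
        now rewrite Rminus_diag, Rabs_R0 in HL. }
      subst zl' zr'.
      pose proof (G_lip _ _ _ _ Hl Hr) as HL. rewrite Rabs_left1 in HL by lra.
      rewrite vdist_sym. rewrite vdist_sym in HL. rewrite Hz, Hz'. unfold vdist in *.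
      replace (zl +v (w - l) / (r - l) *v (zr -v zl) -v (zl +v (u - l) / (r - l) *v (zr -v zl)))
        with (((w - u) / (r - l)) *v (zr -v zl)) by (vec_with ltac:(field; lra)).
      assert (Hp : 0 < / (r - l)) by (apply Rinv_0_lt_compat; lra).
      rewrite vnorm_scal_pos by (apply Rmult_le_pos; lra).
      apply Rle_trans with ((w - u) / (r - l) * (r - l)).
      * apply Rmult_le_compat_l; [apply Rmult_le_pos; lra|lra].
      * right. field. lra.
Qed.

(** The second clause covers limits of the points of [S]: this is how the curve reaches all of [E]
    and not only the nets. *)
Lemma lipschitz_extension : exists g : R -> X,
  (forall s t, 0 <= s <= 1 -> 0 <= t <= 1 -> vdist (g s) (g t) <= len * Rabs (s - t)) /\
  (forall x, (forall eps, 0 < eps -> exists s y, S s y /\ vdist x y < eps) ->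
     exists t, 0 <= t <= 1 /\ g t = x).
Proof.
  destruct S_ne as (s0 & x0 & H0).
  assert (D0 : dom s0).
  { intros eps He. exists s0, x0. split; [easy|]. now rewrite Rminus_diag, Rabs_R0. }
  destruct (dom_sup (fun _ => True) len) as (M & DM & HM & HM').
  { now exists s0. } { intros d Hd _. now apply dom_bound. }
  destruct (dom_inf (fun _ => True) 0) as (m & Dm & Hm & Hm').
  { now exists s0. } { intros d Hd _. now apply dom_bound. }
  assert (HmM : m <= M) by now apply HM'.
  assert (Hex : forall u, m <= u <= M -> exists z, interp u z).
  { intros u Hu.
    destruct (dom_sup (fun d => d <= u) u) as (l & Dl & Hl & Hl'); [now exists m|auto|].
    destruct (dom_inf (fun d => u <= d) u) as (r & Dr & Hr & Hr'); [now exists M|auto|].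
    destruct (dom_G l Dl) as [zl Hzl]. destruct (dom_G r Dr) as [zr Hzr].
    eexists. exists l, r, zl, zr. repeat split; try easy.
    intros d Hd. destruct (Rle_lt_dec d u); [left; now apply Hl'|right; apply Hr'; [easy|lra]]. }
  set (h := fun u => epsilon (inhabits x0) (interp u)).
  assert (Hh : forall u, m <= u <= M -> interp u (h u)).
  { intros u Hu. apply epsilon_spec. now apply Hex. }
  assert (Hrange : forall t, 0 <= t <= 1 -> m <= m + t * (M - m) <= M).
  { intros t Ht. assert (0 <= t * (M - m) <= 1 * (M - m)); [|lra].
    split; [apply Rmult_le_pos; lra|apply Rmult_le_compat_r; lra]. }
  exists (fun t => h (m + t * (M - m))). split.
  - assert (Hle : forall s t, 0 <= s <= 1 -> 0 <= t <= 1 -> s <= t ->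
      vdist (h (m + s * (M - m))) (h (m + t * (M - m))) <= len * Rabs (s - t)).
    { intros s t Hs Ht Hst.
      assert (s * (M - m) <= t * (M - m)) by (apply Rmult_le_compat_r; lra).
      eapply Rle_trans; [apply interp_lip; [now apply Hh, Hrange|now apply Hh, Hrange|lra]|].
      rewrite Rabs_left1 by lra.
      assert ((M - m) * (t - s) <= len * (t - s)) by (apply Rmult_le_compat_r; lra). lra. }
    intros s t Hs Ht. destruct (Rle_lt_dec s t) as [Hst|Hst]; [now apply Hle|].
    rewrite vdist_sym, Rabs_minus_sym. apply Hle; try easy. lra.
  - intros x Hx.
    (* The parameter of [x] is an upper limit: the supremum of those [v] which are exceeded or
       attained by parameters of points arbitrarily close to [x]. No convergent subsequence is
       needed to see that [G u x] holds. *)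
    destruct (completeness (fun v => forall eps, 0 < eps ->
       exists s y, S s y /\ vdist x y < eps /\ v <= s)) as [u Hu].
    { exists len. intros v Hv. destruct (Hv 1) as (s & y & Hs & _ & Hvs); [lra|].
      apply S_bound in Hs. lra. }
    { exists 0. intros eps He. destruct (Hx eps He) as (s & y & Hs & Hy).
      exists s, y. repeat split; try easy. now apply S_bound in Hs. }
    assert (Gu : G u x).
    { intros eps He.
      destruct (is_lub_approx _ _ eps Hu He) as (v & Hv & Hlt).
      assert (Hn : ~ (forall e, 0 < e -> exists s y, S s y /\ vdist x y < e /\ u + eps <= s)).
      { intros Hc. apply Hu in Hc. lra. }
      apply not_all_ex_not in Hn. destruct Hn as [e Hn].
      apply imply_to_and in Hn. destruct Hn as [He' Hn].
      destruct (Hv (Rmin eps e)) as (s & y & Hs & Hy & Hvs).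
      { now apply Rmin_glb_lt. }
      pose proof (Rmin_l eps e). pose proof (Rmin_r eps e).
      exists s, y. repeat split; [easy| |lra].
      assert (s < u + eps).
      { apply Rnot_le_lt. intros Hc. apply Hn. exists s, y. repeat split; try easy. lra. }
      unfold Rabs. destruct Rcase_abs; lra. }
    pose proof (G_dom _ _ Gu) as Du.
    assert (Hu' : m <= u <= M) by (split; [now apply Hm'|now apply HM']).
    assert (Et : exists t, 0 <= t <= 1 /\ m + t * (M - m) = u).
    { destruct (Req_dec m M) as [E|E].
      - exists 0. lra.
      - exists ((u - m) / (M - m)).
        assert (Hp : 0 < / (M - m)) by (apply Rinv_0_lt_compat; lra).
        repeat split.
        + apply Rmult_le_pos; lra.
        + apply (Rmult_le_reg_r (M - m)); [lra|].
          replace ((u - m) / (M - m) * (M - m)) with (u - m) by (field; lra). lra.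
        + field. lra. }
    destruct Et as (t & Ht & Et). exists t. split; [easy|]. rewrite Et.
    destruct (Hh u Hu') as (l & r & zl & zr & Hl & Hr & Hlr & Hd & Hz).
    destruct (interp_ends l r u zl zr _ Hl Hr Hlr Hz) as [A1 A2].
    (* Since [u] is in [dom], it is an end of its gap, where the interpolation returns the value of
       [G]. *)
    apply vdist_eq0. destruct (Hd u Du) as [H|H].
    + pose proof (G_lip _ _ _ _ Hl Gu) as HL. rewrite Rabs_left1 in HL by lra.
      pose proof (vdist_tri (h u) zl x). lra.
    + pose proof (G_lip _ _ _ _ Hr Gu) as HL. rewrite Rabs_right in HL by lra.
      pose proof (vdist_tri (h u) zr x). lra.
Qed.

End Extension.

(** * Limits of nested orderings *)

Lemma chain_vdist_ge0 (l : list X) : 0 <= chain vdist l.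
Proof.
  induction l as [|a [|b l] IH]; [simpl; lra|simpl; lra|].
  rewrite chain_cons2. pose proof (vdist_pos a b). lra.
Qed.

Lemma chain_vdist_cons (a b : X) l : chain vdist (a :: l) <= vdist a b + chain vdist (b :: l).
Proof.
  destruct l as [|c l].
  - simpl. pose proof (vdist_pos a b). lra.
  - rewrite !chain_cons2. pose proof (vdist_tri a b c). lra.
Qed.

Lemma chain_vdist_tail (a : X) l : chain vdist l <= chain vdist (a :: l).
Proof.
  destruct l as [|b l]; [simpl; lra|]. rewrite chain_cons2. pose proof (vdist_pos a b). lra.
Qed.

Lemma chain_vdist_subseq (l l' : list X) : subseq l l' -> chain vdist l <= chain vdist l'.
Proof.
  (* Skipping the head of [l'] alters the link that leads to it, so the induction carries a common
     first point. *)
  intros H. enough (HH : chain vdist l <= chain vdist l' /\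
    forall a, chain vdist (a :: l) <= chain vdist (a :: l')) by apply HH.
  induction H as [|b l l' H [IH1 IH2]|b l l' H [IH1 IH2]].
  - split; [lra|]. intros; lra.
  - split.
    + pose proof (chain_vdist_tail b l'). lra.
    + intros a. rewrite (chain_cons2 _ a b l'). pose proof (chain_vdist_cons a b l).
      specialize (IH2 b). lra.
  - split; [apply IH2|]. intros a. rewrite !chain_cons2. specialize (IH2 b). lra.
Qed.

Definition position (l : list X) (x : X) (s : R) : Prop :=
  exists l1 l2, l = l1 ++ x :: l2 /\ s = chain vdist (l1 ++ [x]).

Lemma subseq_split {T : Type} (l1 l2 : list T) x l' : subseq (l1 ++ x :: l2) l' ->
  exists l1' l2', l' = l1' ++ x :: l2' /\ subseq l1 l1' /\ subseq l2 l2'.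
Proof.
  intros H. remember (l1 ++ x :: l2) as l eqn:E. revert l1 E.
  induction H as [|a l l' H IH|a l l' H IH]; intros l1 E.
  - now destruct l1.
  - destruct (IH l1 E) as (l1' & l2' & -> & H1 & H2).
    exists (a :: l1'), l2'. repeat split; [now apply subseq_skip|easy].
  - destruct l1 as [|b l1]; simpl in E; injection E as -> ->.
    + exists [], l'. repeat split; [constructor|easy].
    + destruct (IH l1 eq_refl) as (l1' & l2' & -> & H1 & H2).
      exists (b :: l1'), l2'. repeat split; [now apply subseq_keep|easy].
Qed.

Lemma subseq_refl {T : Type} (l : list T) : subseq l l.
Proof. induction l; [constructor|now apply subseq_keep]. Qed.

Lemma position_subseq l l' x s : subseq l l' -> position l x s ->
  exists s', position l' x s' /\ s <= s'.
Proof.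
  intros H (l1 & l2 & -> & ->). destruct (subseq_split _ _ _ _ H) as (l1' & l2' & -> & H1 & H2).
  exists (chain vdist (l1' ++ [x])). split; [now exists l1', l2'|].
  apply chain_vdist_subseq. apply subseq_app; [easy|apply subseq_refl].
Qed.

Lemma position_bound l x s : position l x s -> 0 <= s <= chain vdist l.
Proof.
  intros (l1 & l2 & -> & ->). rewrite (chain_split _ l1 x l2).
  pose proof (chain_vdist_ge0 (l1 ++ [x])). pose proof (chain_vdist_ge0 (x :: l2)). lra.
Qed.

Lemma chain_vdist_ends (x y : X) l : vdist x y <= chain vdist (x :: l ++ [y]).
Proof.
  replace (vdist x y) with (chain vdist ([x] ++ [] ++ [y])) by (simpl; ring).
  apply chain_vdist_subseq. apply (subseq_app [x] [x]); [apply subseq_refl|].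
  apply subseq_app; [apply subseq_empty|apply subseq_refl].
Qed.

Lemma position_dist l x y s s' : position l x s -> position l y s' -> vdist x y <= Rabs (s - s').
Proof.
  assert (Hw : forall l1 m (x y : X), vdist x y <=
    chain vdist ((l1 ++ x :: m) ++ [y]) - chain vdist (l1 ++ [x])).
  { intros l1 m x1 y1. rewrite <- app_assoc. simpl app.
    rewrite (chain_split _ l1 x1). pose proof (chain_vdist_ends x1 y1 m). lra. }
  intros (l1 & l2 & -> & ->) (l1' & l2' & E & ->).
  apply app_eq_app in E. destruct E as (m & [[-> E]|[-> E]]).
  - destruct m as [|z m]; simpl in E.
    + injection E as <- <-. rewrite vdist_refl. apply Rabs_pos.
    + injection E as <- ->. rewrite vdist_sym. eapply Rle_trans; [|apply Rle_abs].
      specialize (Hw l1' m y x). lra.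
  - destruct m as [|z m]; simpl in E.
    + injection E as <- <-. rewrite vdist_refl. apply Rabs_pos.
    + injection E as <- ->. rewrite Rabs_minus_sym. eapply Rle_trans; [|apply Rle_abs].
      specialize (Hw l1 m x y). lra.
Qed.

(* The position of a point along the orderings increases from one ordering to the next, and its
   limit serves as the parameter of the point on the curve. *)
Lemma curve_through_orderings (l : nat -> list X) len :
  l O <> [] -> (forall n, NoDup (l n)) -> (forall n, subseq (l n) (l (S n))) ->
  (forall n, chain vdist (l n) <= len) ->
  exists g : R -> X,
    (forall s t, 0 <= s <= 1 -> 0 <= t <= 1 -> vdist (g s) (g t) <= len * Rabs (s - t)) /\
    (forall x, (forall eps, 0 < eps -> exists n y, In y (l n) /\ vdist x y < eps) ->
       exists t, 0 <= t <= 1 /\ g t = x).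
Proof.
  intros Hne Hd Hs Hl.
  set (P := fun x u => exists n, position (l n) x u).
  assert (Hmono : forall n k x u, position (l n) x u ->
    exists u', position (l (n + k)%nat) x u' /\ u <= u').
  { intros n k x u Hu. induction k as [|k IH].
    - exists u. rewrite Nat.add_0_r. split; [easy|lra].
    - destruct IH as (u' & Hu' & Hle).
      destruct (position_subseq _ _ _ _ (Hs (n + k)%nat) Hu') as (u'' & Hu'' & Hle').
      exists u''. rewrite Nat.add_succ_r. split; [easy|lra]. }
  assert (Hlub : forall n x, In x (l n) -> exists s, is_lub (P x) s).
  { intros n x Hx. destruct (completeness (P x)) as [s Hsx]; [| |now exists s].
    - exists len. intros u [k Hu]. apply position_bound in Hu. specialize (Hl k). lra.
    - destruct (in_split _ _ Hx) as (l1 & l2 & E).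
      exists (chain vdist (l1 ++ [x])), n. now exists l1, l2. }
  destruct (lipschitz_extension (fun s x => is_lub (P x) s) len) as (g & Hg1 & Hg2).
  - destruct (l O) as [|x l0] eqn:E; [easy|].
    destruct (Hlub O x) as [s Hsx]; [rewrite E; now left|]. now exists s, x.
  - intros s x Hsx. destruct (is_lub_approx _ _ 1 Hsx) as (u & [n Hu] & _); [lra|].
    split.
    + apply Rle_trans with u; [now apply position_bound in Hu|].
      apply Hsx. now exists n.
    + apply Hsx. intros v [k Hv]. apply position_bound in Hv. specialize (Hl k). lra.
  - intros s x s' x' Hsx Hsx'. apply Rnot_lt_le. intros Hlt.
    set (eps := vdist x x' - Rabs (s - s')).
    assert (He : 0 < eps) by (unfold eps; lra).
    destruct (is_lub_approx _ _ eps Hsx He) as (u & [n Hu] & Hlu).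
    destruct (is_lub_approx _ _ eps Hsx' He) as (u' & [n' Hu'] & Hlu').
    destruct (Hmono n n' x u Hu) as (v & Hv & Huv).
    destruct (Hmono n' n x' u' Hu') as (v' & Hv' & Huv').
    rewrite Nat.add_comm in Hv'.
    pose proof (position_dist _ _ _ _ _ Hv Hv') as HL.
    assert (v <= s) by (apply Hsx; now exists (n + n')%nat).
    assert (v' <= s') by (apply Hsx'; now exists (n + n')%nat).
    unfold eps, Rabs in *. repeat destruct Rcase_abs; lra.
  - exists g. split; [easy|]. intros x Hx. apply Hg2. intros eps He.
    destruct (Hx eps He) as (n & y & Hy & Hxy). destruct (Hlub n y Hy) as [s Hsy].
    now exists s, y.
Qed.

(** * The length of a Lipschitz image *)

Lemma H1_le_lipschitz (g : R -> X) len : 0 <= len ->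
  (forall s t, 0 <= s <= 1 -> 0 <= t <= 1 -> vdist (g s) (g t) <= len * Rabs (s - t)) ->
  continuous_on01 g /\ H1_le (image01 g) len.
Proof.
  intros Hl Hg. split.
  - intros t Ht eps He. exists (eps / (len + 1)).
    assert (Hp : 0 < / (len + 1)) by (apply Rinv_0_lt_compat; lra).
    split; [now apply Rmult_lt_0_compat|].
    intros s Hs Hst. eapply Rle_lt_trans; [now apply Hg|].
    apply Rle_lt_trans with ((len + 1) * Rabs (s - t)).
    + apply Rmult_le_compat_r; [apply Rabs_pos|lra].
    + replace eps with ((len + 1) * (eps / (len + 1))) by (field; lra).
      apply Rmult_lt_compat_l; lra.
  - intros delta Hdelta eps He.
    destruct (inv_small (delta / (len + 1))) as [N HN].
    { apply Rmult_lt_0_compat; [easy|]. apply Rinv_0_lt_compat; lra. }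
    specialize (HN N (le_n N)).
    set (a := / (INR N + 1)) in *. pose proof (pos_INR N) as HN0.
    assert (Ha : 0 < a) by (apply Rinv_0_lt_compat; lra).
    assert (Hla : len * a <= delta).
    { apply Rle_trans with ((len + 1) * (delta / (len + 1))).
      - apply Rmult_le_compat; lra.
      - right. field. lra. }
    assert (HaN : a * (INR N + 1) = 1) by (unfold a; field; lra).
    assert (Hla0 : 0 <= len * a) by (apply Rmult_le_pos; lra).
    (* Images of [N + 1] intervals of length [a = 1 / (N + 1)]. The covering is indexed by all of
       [nat]; its later sets are empty. *)
    set (U := fun (i : nat) (z : X) => (i <= N)%nat /\
      exists t, INR i * a <= t <= INR i * a + a /\ 0 <= t <= 1 /\ g t = z).
    assert (HU : forall i z z', U i z -> U i z' -> vdist z z' <= len * a).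
    { intros i z z' (_ & t & Ht & Ht1 & <-) (_ & t' & Ht' & Ht1' & <-).
      eapply Rle_trans; [now apply Hg|]. apply Rmult_le_compat_l; [easy|].
      unfold Rabs. destruct Rcase_abs; lra. }
    assert (HUd : forall i, diam (U i) <= if Nat.leb i N then len * a else 0).
    { intros i. destruct (Nat.leb_spec i N) as [Hi|Hi].
      - apply diam_le; [apply HU|easy].
      - apply diam_le; [|lra]. intros z z' [Hi' _]. lia. }
    exists U. split; [|split].
    + intros i. split; [exists (len * a); intros; now apply (HU i)|].
      eapply Rle_trans; [apply HUd|]. destruct Nat.leb; lra.
    + intros z (t & Ht & <-).
      assert (Hi : exists i : nat, (i <= N)%nat /\ INR i * a <= t <= INR i * a + a).
      { clear - Ha HaN Ht.
        assert (Hk : forall k : nat, t <= INR k * a + a -> exists i : nat, (i <= k)%nat /\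
          INR i * a <= t <= INR i * a + a).
        { induction k as [|k IH]; intros Hk.
          - exists O. simpl in *. split; [lia|lra].
          - destruct (Rle_lt_dec (INR (S k) * a) t) as [Hle|Hlt].
            + exists (S k). split; [lia|lra].
            + destruct IH as (i & Hi & Hi'); [rewrite S_INR in Hlt; lra|].
              exists i. split; [lia|lra]. }
        apply Hk. lra. }
      destruct Hi as (i & Hi & Hi'). exists i. split; [easy|]. now exists t.
    + intros n.
      assert (Hsum : sum_f_R0 (fun i => diam (U i)) n <= INR (Nat.min n N + 1) * (len * a)).
      { induction n as [|n IH].
        - simpl. specialize (HUd O). simpl in HUd. lra.
        - simpl sum_f_R0. specialize (HUd (S n)).
          destruct (Nat.leb_spec (S n) N) as [Hi|Hi].
          + replace (Nat.min (S n) N + 1)%nat with (S (Nat.min n N + 1)) by lia.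
            rewrite S_INR. lra.
          + replace (Nat.min (S n) N) with (Nat.min n N) by lia. lra. }
      assert (INR (Nat.min n N + 1) <= INR N + 1).
      { rewrite <- S_INR. apply le_INR. lia. }
      assert (INR (Nat.min n N + 1) * (len * a) <= (INR N + 1) * (len * a)).
      { now apply Rmult_le_compat_r. }
      replace ((INR N + 1) * (len * a)) with (len * (a * (INR N + 1))) in * by ring.
      rewrite HaN in *. lra.
Qed.

End LipschitzCurve.

(** * Finiteness *)

Lemma enumerate_bounded {T : Type} (P : T -> Prop) (N : nat) :
  (forall l, NoDup l -> (forall x, In x l -> P x) -> (length l <= N)%nat) ->
  exists l, NoDup l /\ forall x, In x l <-> P x.
Proof.
  intros HN.
  enough (H : forall d l, NoDup l -> (forall x, In x l -> P x) -> (N - length l <= d)%nat ->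
    exists l, NoDup l /\ forall x, In x l <-> P x).
  { apply (H N []); [constructor|easy|simpl; lia]. }
  induction d as [|d IH]; intros l Hd Hl Hn;
    (destruct (classic (exists x, P x /\ ~ In x l)) as [(x & Hx & Hxl)|Hno];
      [|exists l; split; [easy|]; intros x; split; [apply Hl|]; intros Hx; apply NNPP;
        intros Hc; apply Hno; now exists x]).
  - assert (length (x :: l) <= N)%nat.
    { apply HN; [now constructor|]. intros y [<-|Hy]; auto. }
    simpl in *. lia.
  - apply (IH (x :: l)); [now constructor| |simpl; lia].
    intros y [<-|Hy]; auto.
Qed.

Lemma cover_by_lists {T U : Type} (P : T -> U -> Prop) (l : list T) :
  (forall x, In x l -> exists lx, forall y, P x y -> In y lx) ->
  exists L, forall x y, In x l -> P x y -> In y L.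
Proof.
  induction l as [|a l IH]; intros H; [now exists []|].
  destruct IH as [L HL]; [intros x Hx; apply H; now right|].
  destruct (H a ltac:(now left)) as [la Hla].
  exists (la ++ L). intros x y [<-|Hx] Hy; apply in_or_app; [left; auto|right; eauto].
Qed.

Lemma sorted_gap_length {T : Type} (t : T -> R) d b a l : 0 <= d ->
  StronglySorted (fun y z => t y + d <= t z) (a :: l) ->
  (forall z, In z (a :: l) -> t z <= b) -> INR (length l) * d <= b - t a.
Proof.
  intros Hd. revert a; induction l as [|c l IH]; intros a Hs Hb.
  - specialize (Hb a ltac:(now left)). simpl. lra.
  - apply StronglySorted_inv in Hs. destruct Hs as [Hs Ha]. rewrite Forall_forall in Ha.
    specialize (Ha c ltac:(now left)).
    assert (INR (length l) * d <= b - t c) by (apply IH; [easy|]; intros z Hz; apply Hb; now right).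
    change (length (c :: l)) with (S (length l)). rewrite S_INR. lra.
Qed.

Lemma argmin_exists {T : Type} (f : T -> R) a l :
  exists x, In x (a :: l) /\ forall y, In y (a :: l) -> f x <= f y.
Proof.
  revert a; induction l as [|b l IH]; intros a.
  - exists a. split; [now left|]. intros y [<-|[]]. lra.
  - destruct (IH b) as (x & Hx & Hmin). destruct (Rle_lt_dec (f a) (f x)) as [H|H].
    + exists a. split; [now left|]. intros y [<-|Hy]; [lra|]. specialize (Hmin y Hy). lra.
    + exists x. split; [now right|]. intros y [<-|Hy]; [lra|auto].
Qed.

(** * The multiresolution step *)

Definition scale (k : Z) : R := powerRZ 2 (- k).

Lemma scale_pos k : 0 < scale k.
Proof. apply powerRZ_lt. lra. Qed.

Lemma scale_succ k : scale (k + 1) = scale k / 2.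
Proof.
  unfold scale. replace (- (k + 1))%Z with (- k + - 1)%Z by lia.
  rewrite powerRZ_add by lra. simpl. lra.
Qed.

Lemma link_ext {X : Banach} (V V' : list X) s :
  (forall z, In z V <-> In z V') -> link V s = link V' s.
Proof.
  intros H. apply functional_extensionality. intros a.
  apply functional_extensionality. intros b.
  assert (Ha : adjacent V s a b <-> adjacent V' s a b).
  { unfold adjacent. split; intros [H1 H2]; (split; [easy|]); intros z Hz; now apply H2, H. }
  destruct (classic (adjacent V s a b)) as [H1|H1].
  - now rewrite !link_adjacent by tauto.
  - now rewrite !link_not_adjacent by tauto.
Qed.

Lemma rpow_ge0 b p : 0 <= rpow b p.
Proof. unfold rpow. destruct Req_EM_T; [lra|apply Rpower_nonneg]. Qed.

Lemma rpow_pos b p : 0 < b -> rpow b p = Rpower b p.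
Proof. intros H. unfold rpow. destruct Req_EM_T; [lra|easy]. Qed.

Lemma Rpower_1_base p : Rpower 1 p = 1.
Proof. unfold Rpower. now rewrite ln_1, Rmult_0_r, exp_0. Qed.

Section Multiresolution.
Context {X : Banach}.
Variables (A K p : R) (E : X -> Prop) (Xs : Z -> X -> Prop) (M : R).
Hypothesis A_ge : 240 <= A.
Hypothesis p_pos : 0 < p.
Hypothesis K_ge0 : 0 <= K.
Hypothesis smooth : power_smooth X K p.
Hypothesis nets : multiresolution_nets E Xs.
Hypothesis S_bound : S_le E Xs A p M.

(** A ball of level [k + 1] has diameter [A * scale k], so near it [E] is within about
    [beta * A * scale k] of a line. With [delta = 2 A beta], flatness [delta <= 1 / 100] means that
    beta is at most [1 / (200 A)], and at this threshold [weight * beta^p] reaches [1]. *)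
Let weight : R := Rpower (200 * A) p.

Let bt (k : Z) (y : X) : R := beta E (mr_ball A (k, y)).

Lemma mr_ball_succ k (y : X) : mr_ball A ((k + 1)%Z, y) = cball y (A * (scale k / 2)).
Proof. unfold mr_ball. simpl fst. simpl snd. now rewrite <- scale_succ. Qed.

Lemma bt_ge0 k y : 0 <= bt k y.
Proof.
  unfold bt, mr_ball. apply beta_ge0. apply Rmult_lt_0_compat; [lra|apply scale_pos].
Qed.

Lemma weight_large b : 1 / (200 * A) <= b -> 1 <= weight * rpow b p.
Proof.
  intros Hb. assert (Hp : 0 < 1 / (200 * A)).
  { apply Rmult_lt_0_compat; [lra|]. apply Rinv_0_lt_compat. lra. }
  rewrite rpow_pos by lra. unfold weight. rewrite Rpower_mult_distr by lra.
  rewrite <- (Rpower_1_base p). apply Rle_Rpower_l; [lra|]. split; [lra|].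
  apply (Rmult_le_compat_l (200 * A)) in Hb; [|lra].
  replace (200 * A * (1 / (200 * A))) with 1 in Hb by (field; lra). lra.
Qed.

(** [delta] has to be positive although beta may vanish; it is then taken with [delta^p <= eta]. The
    radius [A * scale k / 2 >= 120 * scale k] of the ball takes in all points within [41 * scale k]
    of [y]. *)
Lemma flat_of_small_beta k y eta : 0 < eta -> bt (k + 1) y < 1 / (200 * A) ->
  exists delta (o v : X), 0 < delta <= 1 / 100 /\ vnorm v = 1 /\
    Rpower delta p <= weight * rpow (bt (k + 1) y) p + eta /\
    forall z, E z -> vdist z y <= 41 * scale k ->
      exists s, vdist z (o +v s *v v) <= delta * scale k.
Proof.
  intros Heta Hb. pose proof (bt_ge0 (k + 1) y) as Hb0.
  pose proof (scale_pos k) as Hr.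
  assert (HA : 0 < / A) by (apply Rinv_0_lt_compat; lra).
  assert (Hd : exists delta, 0 < delta <= 1 / 100 /\ bt (k + 1) y < delta * / A /\
    Rpower delta p <= weight * rpow (bt (k + 1) y) p + eta).
  { destruct Hb0 as [Hb0|Hb0].
    - exists (2 * A * bt (k + 1) y).
      assert (Hpos : 0 < A * bt (k + 1) y) by (apply Rmult_lt_0_compat; lra).
      repeat split.
      + lra.
      + apply (Rmult_lt_compat_l (2 * A)) in Hb; [|lra].
        replace (2 * A * (1 / (200 * A))) with (1 / 100) in Hb by (field; lra). lra.
      + replace (2 * A * bt (k + 1) y * / A) with (2 * bt (k + 1) y) by (field; lra). lra.
      + rewrite rpow_pos by easy. unfold weight. rewrite Rpower_mult_distr by lra.
        enough (Rpower (2 * A * bt (k + 1) y) p <= Rpower (200 * A * bt (k + 1) y) p) by lra.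
        apply Rle_Rpower_l; lra.
    - exists (Rmin (1 / 100) (Rpower eta (/ p))). rewrite <- Hb0.
      assert (He : 0 < Rpower eta (/ p)) by (unfold Rpower; apply exp_pos).
      assert (Hm : 0 < Rmin (1 / 100) (Rpower eta (/ p))) by (apply Rmin_glb_lt; lra).
      repeat split; [easy|apply Rmin_l|now apply Rmult_lt_0_compat|].
      assert (Rpower (Rmin (1 / 100) (Rpower eta (/ p))) p <= eta).
      { replace eta with (Rpower (Rpower eta (/ p)) p) at 2.
        - apply Rle_Rpower_l; [lra|]. split; [easy|apply Rmin_r].
        - rewrite Rpower_mult. replace (/ p * p) with 1 by (field; lra). now apply Rpower_1. }
      assert (0 <= weight * rpow 0 p).
      { apply Rmult_le_pos; [apply Rpower_nonneg|apply rpow_ge0]. }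
      lra. }
  destruct Hd as (delta & Hd & Hbd & Hw).
  unfold bt in Hbd. rewrite mr_ball_succ in Hbd.
  destruct (beta_lt_line E y (A * (scale k / 2)) (delta * / A)) as (o & v & Hv & Hline).
  { apply Rmult_lt_0_compat; lra. } { easy. }
  exists delta, o, v. repeat split; try easy; try lra.
  intros z Hz Hzy. destruct (Hline z Hz) as [s Hs].
  - assert (240 * (scale k / 2) <= A * (scale k / 2)) by (apply Rmult_le_compat_r; lra). lra.
  - exists s. replace (delta * scale k) with (delta * / A * (2 * (A * (scale k / 2))))
      by (field; lra). lra.
Qed.

Lemma partial_S_app (l1 l2 : list (Z * X)) :
  partial_S E A p (l1 ++ l2) = partial_S E A p l1 + partial_S E A p l2.
Proof.
  induction l1 as [|a l1 IH]; [unfold partial_S at 2; simpl; ring|].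
  change (partial_S E A p ((a :: l1) ++ l2)) with
    (rpow (beta E (mr_ball A a)) p * diam (mr_ball A a) + partial_S E A p (l1 ++ l2)).
  change (partial_S E A p (a :: l1)) with
    (rpow (beta E (mr_ball A a)) p * diam (mr_ball A a) + partial_S E A p l1).
  rewrite IH. ring.
Qed.

Definition level (k : Z) (l : list X) : list (Z * X) := map (fun y => (k, y)) l.

Lemma partial_S_level k l :
  partial_S E A p (level (k + 1) l) = A * scale k * sumg (fun y => rpow (bt (k + 1) y) p) l.
Proof.
  pose proof (scale_pos k).
  induction l as [|y l IH].
  - unfold partial_S. simpl. ring.
  - change (partial_S E A p (level (k + 1) (y :: l))) with
      (rpow (bt (k + 1) y) p * diam (mr_ball A ((k + 1)%Z, y)) +
       partial_S E A p (level (k + 1) l)).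
    rewrite IH, mr_ball_succ, diam_cball.
    + simpl. field.
    + apply Rmult_le_pos; lra.
Qed.

Lemma level_nodup k l : NoDup l -> NoDup (level k l).
Proof.
  intros H. apply FinFun.Injective_map_NoDup; [|easy]. intros x y Hxy. now injection Hxy.
Qed.

Lemma diam_E_ge0 : 0 <= diam E.
Proof. apply diam_ge0. apply S_bound. Qed.

Lemma partial_S_le l : NoDup l -> (forall kx, In kx l -> Xs (fst kx) (snd kx)) ->
  diam E + partial_S E A p l <= M.
Proof. apply S_bound. Qed.

Lemma level_S_le k l : NoDup l -> (forall x, In x l -> Xs k x) ->
  partial_S E A p (level k l) <= M.
Proof.
  intros Hd Hl. pose proof diam_E_ge0.
  assert (diam E + partial_S E A p (level k l) <= M); [|lra].
  apply partial_S_le; [now apply level_nodup|].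
  intros kx Hkx. apply in_map_iff in Hkx. destruct Hkx as (x & <- & Hx). simpl. auto.
Qed.

Lemma net_sep k x y : Xs k x -> Xs k y -> x <> y -> scale k <= vdist x y.
Proof. intros. now apply (proj2 nets k). Qed.

Lemma net_in k x : Xs k x -> E x.
Proof. apply (proj2 nets k). Qed.

Lemma net_cover k x : E x -> exists y, Xs k y /\ vdist x y < scale k.
Proof. apply (proj2 nets k). Qed.

Lemma net_succ k x : Xs k x -> Xs (k + 1) x.
Proof. apply (proj1 nets k). Qed.

Lemma weight_pos : 0 < weight.
Proof. unfold weight, Rpower. apply exp_pos. Qed.

(** Near a line the coordinates lie in an interval of length [6 * scale k] with gaps of at least
    [2/5 * scale k]; [20] is a generous count. *)
Lemma flat_territory_length k y l : Xs (k + 1) y -> bt (k + 1) y < 1 / (200 * A) ->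
  NoDup l -> (forall z, In z l -> Xs (k + 1) z /\ vdist z y <= 2 * scale k) ->
  (length l <= 20)%nat.
Proof.
  intros Hy Hb Hd Hl. pose proof (scale_pos k) as Hr.
  destruct (flat_of_small_beta k y 1) as (delta & o & v & Hdel & Hv & _ & H); [lra|easy|].
  set (t := fun z => epsilon (inhabits 0) (fun s => vdist z (o +v s *v v) <= delta * scale k)).
  assert (Hsep : forall a b, In a (y :: l) -> In b (y :: l) -> a <> b ->
    scale k / 2 <= vdist a b).
  { intros a b Ha Hb' Hab. rewrite <- scale_succ. apply (net_sep (k + 1)); try easy.
    - destruct Ha as [<-|Ha]; [easy|now apply Hl].
    - destruct Hb' as [<-|Hb']; [easy|now apply Hl]. }
  assert (Hc : flat_chart (y :: l) (scale k) y delta t).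
  { split; [easy|]. exists o, v. split; [easy|]. intros z Hz Hzy.
    apply (epsilon_spec (inhabits 0) (fun s => vdist z (o +v s *v v) <= delta * scale k)).
    apply H; [|lra]. apply (net_in (k + 1)). destruct Hz as [<-|Hz]; [easy|now apply Hl]. }
  assert (Hn : forall z, In z l -> near (y :: l) (scale k) y z).
  { intros z Hz. split; [now right|]. apply Hl in Hz. lra. }
  assert (Ny : near (y :: l) (scale k) y y).
  { split; [now left|]. rewrite vdist_refl. lra. }
  destruct (sort_by_key t l Hd) as (l' & Hp & Hs).
  { intros a b Ha Hb' Hab. apply (chart_inj (y :: l) (scale k) Hr Hsep y delta t); auto. }
  assert (Hl' : forall z, In z l' -> In z l).
  { intros z. apply Permutation_in. now symmetry. }
  rewrite (Permutation_length Hp). destruct l' as [|a l']; [simpl; lia|].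
  assert (Ht : forall z, In z (a :: l') -> t y - 3 * scale k <= t z <= t y + 3 * scale k).
  { intros z Hz. apply Hl' in Hz.
    pose proof (chart_iso (y :: l) (scale k) Hr y delta t z y Hc (Hn z Hz) Ny) as [[I1 I2] _].
    apply Hl in Hz. lra. }
  assert (Hg : INR (length l') * (2 / 5 * scale k) <= t y + 3 * scale k - t a).
  { apply sorted_gap_length; [lra| |intros z Hz; now apply Ht].
    eapply StronglySorted_weaken; [|exact Hs]. intros b c Hb' Hc' Hbc.
    apply (chart_gap (y :: l) (scale k) Hr Hsep y delta t); auto. }
  specialize (Ht a ltac:(now left)).
  assert (INR (length l') <= 19).
  { apply (Rmult_le_reg_r (2 / 5 * scale k)); lra. }
  replace 19 with (INR 19) in * by (simpl; lra).
  apply INR_le in H0. simpl. lia.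
Qed.

(** Each heavy point contributes a fixed amount to the part of the sum at its level, which is at
    most [M]. *)
Lemma heavy_territory_length k l : NoDup l ->
  (forall z, In z l -> Xs (k + 1) z /\ 1 / (200 * A) <= bt (k + 1) z) ->
  INR (length l) <= weight * M / (A * scale k).
Proof.
  intros Hd Hl. pose proof (scale_pos k) as Hr. pose proof weight_pos as Hw.
  assert (HAr : 0 < A * scale k) by (apply Rmult_lt_0_compat; lra).
  assert (H1 : INR (length l) <= sumg (fun y => weight * rpow (bt (k + 1) y) p) l).
  { apply sumg_length. intros y Hy. apply weight_large. now apply Hl. }
  assert (H2 : partial_S E A p (level (k + 1) l) <= M).
  { apply level_S_le; [easy|]. intros x Hx. now apply Hl. }
  rewrite partial_S_level in H2.
  assert (H3 : sumg (fun y => weight * rpow (bt (k + 1) y) p) l =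
    weight * sumg (fun y => rpow (bt (k + 1) y) p) l).
  { clear. induction l as [|y l IH]; simpl; [ring|]. rewrite IH. ring. }
  rewrite H3 in H1. eapply Rle_trans; [exact H1|].
  apply (Rmult_le_reg_r (A * scale k)); [easy|].
  replace (weight * M / (A * scale k) * (A * scale k)) with (weight * M).
  - rewrite Rmult_assoc. apply Rmult_le_compat_l; lra.
  - field. lra.
Qed.

(** Every new point is within [scale k] of one of the finitely many old ones. Among the new points
    near one old point, either one has small beta and forces all of them close to a line, or all are
    heavy. *)
Lemma net_finite_succ k l : (forall x, In x l <-> Xs k x) ->
  exists l', NoDup l' /\ forall x, In x l' <-> Xs (k + 1) x.
Proof.
  intros Hl.
  destruct (cover_by_lists (fun x y => Xs (k + 1) y /\ vdist y x < scale k) l) as [L HL].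
  - intros x Hx. set (P := fun y => Xs (k + 1) y /\ vdist y x < scale k).
    enough (HP : exists N, forall l, NoDup l -> (forall y, In y l -> P y) -> (length l <= N)%nat).
    { destruct HP as [N HN]. destruct (enumerate_bounded P N HN) as (lx & _ & Hlx).
      exists lx. intros y Hy. now apply Hlx. }
    destruct (classic (exists y, P y /\ bt (k + 1) y < 1 / (200 * A))) as [(y & Hy & Hb)|Hn].
    + exists 20%nat. intros l' Hd Hl'. apply (flat_territory_length k y); try easy; [apply Hy|].
      intros z Hz. apply Hl' in Hz. split; [apply Hz|].
      destruct Hz as [_ Hz]. destruct Hy as [_ Hy]. pose proof (vdist_tri z x y).
      rewrite (vdist_sym x y) in *. lra.
    + exists (Z.to_nat (up (weight * M / (A * scale k)))). intros l' Hd Hl'.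
      assert (H : INR (length l') <= weight * M / (A * scale k)).
      { apply heavy_territory_length; [easy|]. intros z Hz. apply Hl' in Hz.
        split; [apply Hz|]. apply Rnot_lt_le. intros Hlt. apply Hn. now exists z. }
      destruct (archimed (weight * M / (A * scale k))) as [Hup _].
      assert (INR (length l') < IZR (up (weight * M / (A * scale k)))) by lra.
      rewrite INR_IZR_INZ in H0. apply lt_IZR in H0. lia.
  - apply (enumerate_bounded (Xs (k + 1)) (length L)).
    intros l' Hd Hl'. apply NoDup_incl_length; [easy|]. intros y Hy. apply Hl' in Hy.
    destruct (net_cover k y (net_in _ _ Hy)) as (x & Hx & Hxy).
    apply (HL x y); [now apply Hl|easy].
Qed.

Definition cost (k : Z) (l : list X) : R := chain (link l (scale k)) l + 6 * scale k.

(** [mu] absorbs the positive [eta] that flatness costs even where beta vanishes; it is shared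
    equally among the points of the new net. *)
Lemma multiresolution_step k l mu : l <> [] -> NoDup l -> (forall x, In x l <-> Xs k x) ->
  0 < mu ->
  exists l', NoDup l' /\ (forall x, In x l' <-> Xs (k + 1) x) /\ subseq l l' /\
    cost (k + 1) l' <=
      cost k l + 2 * step_const K p * weight / A * partial_S E A p (level (k + 1) l') + mu.
Proof.
  intros Hne Hd Hl Hmu. pose proof (scale_pos k) as Hr.
  destruct (net_finite_succ k l Hl) as (LY & HdY & HY).
  assert (Hpr : forall y, exists x, In x l /\ forall x', In x' l -> vdist y x <= vdist y x').
  { intros y. destruct l as [|a l]; [easy|]. apply argmin_exists. }
  set (pr := fun y => proj1_sig (constructive_indefinite_description _ (Hpr y))).
  assert (Hpr' : forall y, In (pr y) l /\ forall x', In x' l -> vdist y (pr y) <= vdist y x').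
  { intros y. exact (proj2_sig (constructive_indefinite_description _ (Hpr y))). }
  clearbody pr.
  pose proof (step_const_ge K p K_ge0) as HS.
  set (S := step_const K p) in *.
  set (n := INR (length LY)). assert (Hn : 0 <= n) by apply pos_INR.
  assert (HSr : 0 < 2 * S * scale k * (n + 1)).
  { repeat apply Rmult_lt_0_compat; lra. }
  set (eta := mu / (2 * S * scale k * (n + 1))).
  assert (Heta : 0 < eta).
  { apply Rmult_lt_0_compat; [easy|]. now apply Rinv_0_lt_compat. }
  set (g := fun y => weight * rpow (bt (k + 1) y) p + eta).
  assert (Hg0 : forall y, 0 <= weight * rpow (bt (k + 1) y) p).
  { intros y. apply Rmult_le_pos; [apply Rpower_nonneg|apply rpow_ge0]. }
  destruct (refine_ordering l LY (scale k) pr Hr) with (K := K) (p := p) (g := g)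
    as (l' & Hp & Hsub & Hcost); try assumption; try lra.
  - intros x Hx. apply HY, net_succ. now apply Hl.
  - intros x y Hx Hy. apply net_sep; now apply Hl.
  - intros x y Hx Hy. rewrite <- scale_succ. apply net_sep; now apply HY.
  - intros y _. apply Hpr'.
  - intros y Hy. destruct (net_cover k y) as (x & Hx & Hxy).
    { apply (net_in (k + 1)). now apply HY. }
    eapply Rle_lt_trans; [|exact Hxy]. apply Hpr'. now apply Hl.
  - intros y x _ Hx. now apply Hpr'.
  - intros y _. unfold g. specialize (Hg0 y). lra.
  - intros y Hy. destruct (Rle_lt_dec (1 / (200 * A)) (bt (k + 1) y)) as [Hb|Hb].
    + left. apply weight_large in Hb. unfold g. lra.
    + right. destruct (flat_of_small_beta k y eta Heta Hb)
        as (delta & o & v & H1 & H2 & H3 & H4).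
      exists delta, o, v. repeat split; try easy.
      intros z Hz. apply H4, (net_in (k + 1)). now apply HY.
  - assert (Hl' : forall z, In z LY <-> In z l').
    { intros z. split; apply Permutation_in; [easy|now symmetry]. }
    exists l'. split; [now apply (Permutation_NoDup Hp)|].
    split; [intros x; rewrite <- Hl'; apply HY|]. split; [easy|].
    unfold cost. rewrite scale_succ, <- (link_ext LY l') by easy.
    fold S in Hcost. eapply Rle_trans; [exact Hcost|]. rewrite partial_S_level.
    rewrite <- (sumg_perm _ LY l' Hp).
    assert (Hsum : forall l1, sumg g l1 =
      weight * sumg (fun y => rpow (bt (k + 1) y) p) l1 + eta * INR (length l1)).
    { induction l1 as [|y l1 IH]; [simpl; ring|].
      change (length (y :: l1)) with (Datatypes.S (length l1)). rewrite S_INR. simpl.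
      rewrite IH. unfold g. ring. }
    rewrite (Hsum LY). fold n.
    assert (He : 2 * S * scale k * (eta * n) <= mu).
    { replace mu with (2 * S * scale k * (eta * (n + 1))) by (unfold eta; field; lra).
      apply Rmult_le_compat_l; [repeat apply Rmult_le_pos; lra|].
      apply Rmult_le_compat_l; lra. }
    set (sg := sumg (fun y => rpow (bt (k + 1) y) p) LY).
    replace (2 * S * weight / A * (A * scale k * sg)) with (2 * S * scale k * (weight * sg))
      by (field; lra).
    lra.
Qed.

(** At a scale above [diam E] a net has a single point; as the scale is at most [2 * diam E], the
    initial cost, which is the reserve alone, is at most [12 * diam E]. *)
Lemma initial_scale D : 0 < D -> exists k, D < scale k <= 2 * D.
Proof.
  intros HD. set (q := ln D / ln 2).
  assert (H2 : 0 < ln 2) by (rewrite <- ln_1; apply ln_increasing; lra).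
  destruct (archimed q) as [H1 H3].
  exists (- up q)%Z. unfold scale. rewrite Z.opp_involutive, powerRZ_Rpower by lra.
  unfold Rpower. assert (Eq : q * ln 2 = ln D) by (unfold q; field; lra).
  split.
  - rewrite <- (exp_ln D HD) at 1. apply exp_increasing. rewrite <- Eq.
    now apply Rmult_lt_compat_r.
  - rewrite <- (exp_ln (2 * D)) by lra. rewrite ln_mult by lra.
    assert (Hle : IZR (up q) * ln 2 <= ln 2 + ln D).
    { rewrite <- Eq. replace (ln 2 + q * ln 2) with ((q + 1) * ln 2) by ring.
      apply Rmult_le_compat_r; lra. }
    destruct Hle as [Hle| ->]; [left; now apply exp_increasing|lra].
Qed.

Let C0 : R := 2 * step_const K p * weight / A.

(** The second component of [s] lists the balls charged so far, none of a level beyond the current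
    one. Those of the next level are therefore new, and [S_le] is applied once to the whole list
    instead of once per scale. The last term is the sum of the errors [M / 2^j] for [j] from [1] to
    [n]. *)
Let state (k0 : Z) (n : nat) (s : list X * list (Z * X)) : Prop :=
  NoDup (fst s) /\ (forall x, In x (fst s) <-> Xs (k0 + Z.of_nat n) x) /\ fst s <> [] /\
  NoDup (snd s) /\
  (forall kx, In kx (snd s) -> Xs (fst kx) (snd kx) /\ (fst kx <= k0 + Z.of_nat n)%Z) /\
  cost (k0 + Z.of_nat n) (fst s) <=
    12 * diam E + C0 * partial_S E A p (snd s) + M * (1 - (1 / 2) ^ n).

Lemma state_step k0 n s : 0 < M -> state k0 n s ->
  exists s', state k0 (S n) s' /\ subseq (fst s) (fst s').
Proof.
  destruct s as [l lam]. intros HM (H1 & H2 & H3 & H4 & H5 & H6). simpl fst in *. simpl snd in *.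
  destruct (multiresolution_step (k0 + Z.of_nat n) l (M * (1 / 2) ^ S n) H3 H1 H2)
    as (l' & Hd & Hl' & Hs & Hc).
  { apply Rmult_lt_0_compat; [easy|]. apply pow_lt. lra. }
  assert (Ek : (k0 + Z.of_nat (S n) = k0 + Z.of_nat n + 1)%Z) by lia.
  exists (l', level (k0 + Z.of_nat n + 1) l' ++ lam). split; [|easy].
  unfold state. simpl fst. simpl snd. rewrite Ek. repeat split.
  - easy.
  - apply Hl'.
  - apply Hl'.
  - intros ->. destruct l as [|a l]; [easy|]. inversion Hs.
  - apply NoDup_app; [now apply level_nodup|easy|].
    intros kx Hkx Hkx'. apply in_map_iff in Hkx. destruct Hkx as (x & <- & Hx).
    apply H5 in Hkx'. simpl in Hkx'. lia.
  - apply in_app_or in H. destruct H as [H|H]; [|now apply H5].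
    apply in_map_iff in H. destruct H as (x & <- & Hx). now apply Hl'.
  - apply in_app_or in H. destruct H as [H|H]; [|apply H5 in H; lia].
    apply in_map_iff in H. destruct H as (x & <- & Hx). simpl. lia.
  - rewrite partial_S_app. fold C0 in Hc. simpl pow in *. lra.
Qed.

(** [26 = 2 (12 + 1)]: the length is at most twice the cost, which starts from at most [12 * diam E]
    and collects errors of at most [M]. *)
Lemma nested_orderings x0 : E x0 -> 0 < diam E ->
  exists (k0 : Z) (l : nat -> list X),
    l O <> [] /\ (forall n, NoDup (l n)) /\
    (forall n x, In x (l n) <-> Xs (k0 + Z.of_nat n) x) /\
    (forall n, subseq (l n) (l (S n))) /\
    (forall n, chain vdist (l n) <= (26 + 2 * C0) * M).
Proof.
  intros Hx0 HD.
  assert (HDM : diam E <= M).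
  { pose proof (partial_S_le [] (NoDup_nil _)) as H. unfold partial_S in H. simpl in H.
    enough (diam E + 0 <= M) by lra. now apply H. }
  assert (HC0 : 0 <= C0).
  { unfold C0. pose proof (step_const_ge K p K_ge0). pose proof weight_pos.
    repeat apply Rmult_le_pos; try lra. apply Rlt_le, Rinv_0_lt_compat. lra. }
  destruct (initial_scale (diam E) HD) as (k0 & Hk1 & Hk2).
  destruct (net_cover k0 x0 Hx0) as (x1 & Hx1 & _).
  assert (H0 : state k0 O ([x1], [])).
  { unfold state. simpl fst. simpl snd. change (Z.of_nat 0) with 0%Z. rewrite Z.add_0_r.
    repeat split; try easy; try (repeat constructor; easy).
    - now intros [<-|[]].
    - intros Hx. left. apply NNPP. intros Hn.
      pose proof (net_sep k0 x1 x Hx1 Hx Hn).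
      pose proof (vdist_le_diam E x1 x (proj1 S_bound) (net_in _ _ Hx1) (net_in _ _ Hx)). lra.
    - unfold cost, partial_S. simpl. lra. }
  assert (Hstep : forall n (s : {s | state k0 n s}), exists s' : {s | state k0 (S n) s},
    subseq (fst (proj1_sig s)) (fst (proj1_sig s'))).
  { intros n [s Hs]. destruct (state_step k0 n s ltac:(lra) Hs) as (s' & Hs' & Hsub).
    now exists (exist _ s' Hs'). }
  set (next := fun n s => proj1_sig (constructive_indefinite_description _ (Hstep n s))).
  assert (Hnext : forall n s, subseq (fst (proj1_sig s)) (fst (proj1_sig (next n s)))).
  { intros n s. exact (proj2_sig (constructive_indefinite_description _ (Hstep n s))). }
  set (sq := nat_rect (fun n => {s | state k0 n s}) (exist _ _ H0) next).
  assert (Hst : forall n, state k0 n (proj1_sig (sq n))) by (intros n; apply (proj2_sig (sq n))).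
  exists k0, (fun n => fst (proj1_sig (sq n))). repeat split.
  - now simpl.
  - intros n. apply (Hst n).
  - apply (Hst n).
  - apply (Hst n).
  - intros n. apply (Hnext n (sq n)).
  - intros n. destruct (Hst n) as (_ & _ & _ & H4 & H5 & H6).
    set (l := fst (proj1_sig (sq n))) in *. set (lam := snd (proj1_sig (sq n))) in *.
    assert (HS : diam E + partial_S E A p lam <= M).
    { apply partial_S_le; [easy|]. intros kx Hkx. now apply H5. }
    set (k := (k0 + Z.of_nat n)%Z) in *. pose proof (scale_pos k) as Hk.
    assert (Hch : chain vdist l <= 2 * chain (link l (scale k)) l).
    { assert (Hlk : forall a b, vdist a b <= 2 * link l (scale k) a b).
      { intros a b. pose proof (link_ge_half l (scale k) a b (Rlt_le _ _ Hk)). lra. }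
      generalize l at 1 3. intros l1.
      induction l1 as [|a [|b l1] IH]; [simpl; lra|simpl; lra|].
      rewrite !chain_cons2. specialize (Hlk a b). lra. }
    assert (Hpn : 0 < (1 / 2) ^ n) by (apply pow_lt; lra).
    assert (M * (1 - (1 / 2) ^ n) <= M * 1) by (apply Rmult_le_compat_l; lra).
    assert (C0 * partial_S E A p lam <= C0 * M) by (apply Rmult_le_compat_l; lra).
    unfold cost in H6. lra.
Qed.

Lemma rectifiable_curve_through : exists g : R -> X,
  continuous_on01 g /\ (forall x, E x -> image01 g x) /\
  H1_le (image01 g) ((26 + 2 * C0) * M).
Proof.
  pose proof diam_E_ge0 as HD.
  assert (HDM : diam E <= M).
  { enough (diam E + 0 <= M) by lra.
    apply (partial_S_le [] (NoDup_nil _)). now intros kx []. }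
  assert (HC0 : 0 <= C0).
  { unfold C0. pose proof (step_const_ge K p K_ge0). pose proof weight_pos.
    repeat apply Rmult_le_pos; try lra. apply Rlt_le, Rinv_0_lt_compat. lra. }
  assert (Hlen : 0 <= (26 + 2 * C0) * M) by (apply Rmult_le_pos; lra).
  (* [initial_scale] asks for a positive diameter; the empty set and one-point sets get a constant
     curve. *)
  assert (Hconst : forall c : X, (forall x, E x -> x = c) -> exists g : R -> X,
    continuous_on01 g /\ (forall x, E x -> image01 g x) /\
    H1_le (image01 g) ((26 + 2 * C0) * M)).
  { intros c Hc. exists (fun _ => c).
    destruct (H1_le_lipschitz (fun _ => c) ((26 + 2 * C0) * M) Hlen) as [H1 H2].
    { intros s t _ _. rewrite vdist_refl. apply Rmult_le_pos; [easy|apply Rabs_pos]. }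
    split; [easy|]. split; [|easy]. intros x Hx. exists 0. split; [lra|]. symmetry. auto. }
  destruct (classic (exists x, E x)) as [[x0 Hx0]|Hn].
  2:{ apply (Hconst vzero). intros x Hx. exfalso. apply Hn. now exists x. }
  destruct HD as [HD|HD].
  2:{ apply (Hconst x0). intros x Hx. apply vdist_eq0. rewrite HD.
      apply vdist_le_diam; [apply S_bound|easy|easy]. }
  destruct (nested_orderings x0 Hx0 HD) as (k0 & l & H1 & H2 & H3 & H4 & H5).
  destruct (curve_through_orderings l _ H1 H2 H4 H5) as (g & Hg1 & Hg2).
  exists g. destruct (H1_le_lipschitz g _ Hlen Hg1) as [Hc HH].
  split; [easy|]. split; [|easy]. intros x Hx.
  apply Hg2. intros eps He.
  assert (Hsc : exists n, scale (k0 + Z.of_nat n) < eps).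
  { pose proof (scale_pos k0) as Hk.
    destruct (pow_lt_1_zero (1 / 2)) with (y := eps / scale k0) as [N HN].
    - rewrite Rabs_right; lra.
    - apply Rmult_lt_0_compat; [easy|now apply Rinv_0_lt_compat].
    - exists N. specialize (HN N (le_n N)).
      assert (Hp : 0 < (1 / 2) ^ N) by (apply pow_lt; lra).
      rewrite Rabs_right in HN by lra.
      assert (Es : forall n, scale (k0 + Z.of_nat n) = scale k0 * (1 / 2) ^ n).
      { induction n as [|n IH].
        - simpl. rewrite Z.add_0_r. ring.
        - replace (k0 + Z.of_nat (S n))%Z with (k0 + Z.of_nat n + 1)%Z by lia.
          rewrite scale_succ, IH. simpl. field. }
      rewrite Es. apply (Rmult_lt_compat_l (scale k0)) in HN; [|easy].
      replace (scale k0 * (eps / scale k0)) with eps in HN by (field; lra). easy. }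
  destruct Hsc as [n Hn]. destruct (net_cover (k0 + Z.of_nat n) x Hx) as (y & Hy & Hxy).
  exists n, y. split; [now apply H3|lra].
Qed.

End Multiresolution.

(** * From the modulus of smoothness to the constant *)

Lemma power_smooth_of_modulus (X : Banach) rho K p :
  is_modulus_of_smoothness X rho -> (forall t, 0 < t -> rho t <= K * Rpower t p) ->
  power_smooth X K p.
Proof.
  intros Hm HK x y Hx Hy.
  destruct (Hm (vnorm y) (Rlt_le _ _ Hy)) as [Hub _]. specialize (HK _ Hy).
  assert ((vnorm (x +v y) + vnorm (x -v y)) / 2 - 1 <= rho (vnorm y)); [|lra].
  apply Hub. now exists x, y.
Qed.

Theorem mainTheorem4 :
  forall (A : R) (rho : R -> R) (p : R), 240 <= A ->
  exists C : R, 0 <= C /\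
  forall (X : Banach), is_modulus_of_smoothness X rho ->
    uniformly_smooth_mod rho -> smoothness_power_type_mod rho p ->
  forall (E : X -> Prop) (Xs : Z -> X -> Prop) (M : R),
    multiresolution_nets E Xs ->
    S_le E Xs A p M ->
    exists g : R -> X,
      continuous_on01 g /\
      (forall x, E x -> image01 g x) /\
      H1_le (image01 g) (C * M).
Proof.
  intros A rho p HA.
  (* [C] is chosen before the space, so [K] has to come from [rho] alone. If [rho] is not of power
     type [p], no space meets the premises. *)
  destruct (classic (smoothness_power_type_mod rho p)) as [(Hp & _ & K & HK & Hrho)|Hn].
  - exists (26 + 2 * (2 * step_const K p * Rpower (200 * A) p / A)). split.
    + pose proof (step_const_ge K p (Rlt_le _ _ HK)).
      assert (0 <= 2 * step_const K p * Rpower (200 * A) p / A); [|lra].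
      repeat apply Rmult_le_pos; try lra; [apply Rpower_nonneg|].
      apply Rlt_le, Rinv_0_lt_compat. lra.
    + intros X Hm _ _ E Xs M Hnets HS.
      apply (rectifiable_curve_through A K p E Xs M); try easy; try lra.
      now apply (power_smooth_of_modulus X rho).
  - exists 0. split; [lra|]. intros X _ _ H. contradiction.
Qed.
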